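(* Let $A\in\mathcal{B}(\mathcal{H})$ be a strictly positive operator and let $B\in\mathcal{B}(\mathcal{H})$ be a positive operator such that $mA\le B\le MA$, where $0<m<M$. Put $$K_{m,M}(A,B)=A\natural_2B+MmA-(M+m)B.$$ Then for every $-1\le p\le1$ with $p\ne0$, $$\widetilde L_{m,M,p}(A|B)-\frac{1-p}{2M^{2-p}}K_{m,M}(A,B)\le T_p(A|B)\le\widetilde L_{m,M,p}(A|B)-\frac{1-p}{2m^{2-p}}K_{m,M}(A,B),$$ where $$\widetilde L_{m,M,p}(A|B)=\frac{-1}{p(M-m)}\left\{\left(M-m+Mm\left(M^{p-1}-m^{p-1}\right)\right)A-\left(M^p-m^p\right)B\right\}.$$ Moreover, $$\widetilde L_{m,M}(A|B)-\frac{1}{2M^2}K_{m,M}(A,B)\le S(A|B)\le\widetilde L_{m,M}(A|B)-\frac{1}{2m^2}K_{m,M}(A,B),$$ where $$\widetilde L_{m,M}(A|B)=\frac{1}{M-m}\left\{(B-mA)\log M+(MA-B)\log m\right\}.$$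
   Context: $\mathcal{H}$ is a Hilbert space and $\mathcal{B}(\mathcal{H})$ is the algebra of bounded linear operators on it; an operator is strictly positive if it is positive and invertible; $\le$ is the Loewner order. For $p\in\mathbb{R}$, $A\natural_pB:=A^{1/2}\left(A^{-1/2}BA^{-1/2}\right)^pA^{1/2}$. The Tsallis relative operator entropy is $T_p(A|B):=\frac{A\natural_pB-A}{p}$ for $-1\le p\le1$, $p\ne0$. The relative operator entropy is $S(A|B):=A^{1/2}\log\left(A^{-1/2}BA^{-1/2}\right)A^{1/2}$. *)

(* Defs.v *)
From HB Require Import structures.
From mathcomp Require Import all_boot all_order all_algebra.
From mathcomp Require Import sesquilinear complex.
From mathcomp Require Import all_classical all_reals all_analysis.

Set Implicit Arguments.
Unset Strict Implicit.
Unset Printing Implicit Defensive.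

Import Order.TTheory GRing.Theory Num.Theory numFieldNormedType.Exports.
Local Open Scope classical_set_scope.
Local Open Scope complex_scope.
Local Open Scope ring_scope.

(* A complex Hilbert space: the norm of a Banach space over R[i] comes from an
   inner product, linear in its first argument and antilinear in the second. *)
HB.mixin Record isHilbert (R : realType) H of CompleteNormedModule R[i] H := {
  inner : {dot H for @Num.conj R[i]};
  sqr_norm_inner : forall x : H, `|x| ^+ 2 = inner x x
}.

#[short(type="hilbertType")]
HB.structure Definition Hilbert (R : realType) :=
  { H of isHilbert R H & CompleteNormedModule R[i] H }.

(* Operators are functions H -> H, added and scaled pointwise; B(H) consists of
   those satisfying [bounded_op]. *)
Definition bounded_op (R : realType) (H : hilbertType R) (T : H -> H) : Prop :=
  linear T /\ exists c : R, forall x : H, `|T x| <= c%:C * `|x|.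

Definition invertible_op (R : realType) (H : hilbertType R) (T : H -> H) :
    Prop :=
  exists S : H -> H, [/\ bounded_op S, S \o T = id & T \o S = id].

(* The order of R[i] makes [0 <= z] mean that z is real and nonnegative, so a
   positive bounded operator is self-adjoint. *)
Definition positive_op (R : realType) (H : hilbertType R) (T : H -> H) : Prop :=
  forall x : H, 0 <= inner (T x) x.

Definition strictly_positive_op (R : realType) (H : hilbertType R)
    (T : H -> H) : Prop :=
  positive_op T /\ invertible_op T.

Definition loewner_le (R : realType) (H : hilbertType R) (S T : H -> H) :
    Prop :=
  positive_op (T - S).

Definition spectrum (R : realType) (H : hilbertType R) (T : H -> H) :
    set R[i] :=
  [set z : R[i] | ~ invertible_op (T - z *: id)].

Definition op_poly (R : realType) (H : hilbertType R) (p : {poly R})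
    (T : H -> H) : H -> H :=
  \sum_(i < size p) (p`_i)%:C *: (iter i T : H -> H).

Definition op_cvg (R : realType) (H : hilbertType R) (S : nat -> H -> H)
    (T : H -> H) : Prop :=
  forall e : R, 0 < e ->
    \forall n \near \oo, forall x : H, `|S n x - T x| <= e%:C * `|x|.

(* Continuous functional calculus of a self-adjoint operator T, whose spectrum
   is real: f(T) is the norm limit of p_n(T) for polynomials p_n converging to f
   uniformly on the spectrum. *)
Definition is_cfc (R : realType) (H : hilbertType R) (f : R -> R)
    (T F : H -> H) : Prop :=
  bounded_op F /\
  exists p : nat -> {poly R},
    {uniform [set t : R | spectrum T t%:C], (fun n => horner (p n)) @ \oo --> f}
    /\ op_cvg (fun n => op_poly (p n) T) F.

(* Junk value 0 when f(T) does not exist. *)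
Definition cfc (R : realType) (H : hilbertType R) (f : R -> R) (T : H -> H) :
    H -> H :=
  xget 0 [set F | is_cfc f T F].

(* On a strictly positive operator [t `^ r] is continuous on the spectrum for every
   real r, so that r = 1/2 and r = -1/2 give the square root and its inverse. *)
Definition op_pow (R : realType) (H : hilbertType R) (T : H -> H) (r : R) :
    H -> H :=
  cfc (fun t : R => t `^ r) T.

Definition op_log (R : realType) (H : hilbertType R) (T : H -> H) : H -> H :=
  cfc (@ln R) T.

Definition op_ratio (R : realType) (H : hilbertType R) (A B : H -> H) :
    H -> H :=
  op_pow A (- 2^-1) \o B \o op_pow A (- 2^-1).

Definition natural_op (R : realType) (H : hilbertType R) (p : R)
    (A B : H -> H) : H -> H :=
  op_pow A 2^-1 \o op_pow (op_ratio A B) p \o op_pow A 2^-1.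

Definition tsallis_entropy (R : realType) (H : hilbertType R) (p : R)
    (A B : H -> H) : H -> H :=
  (p^-1)%:C *: (natural_op p A B - A).

Definition rel_op_entropy (R : realType) (H : hilbertType R) (A B : H -> H) :
    H -> H :=
  op_pow A 2^-1 \o op_log (op_ratio A B) \o op_pow A 2^-1.

Definition K_op (R : realType) (H : hilbertType R) (m M : R) (A B : H -> H) :
    H -> H :=
  natural_op 2 A B + (M * m)%:C *: A - (M + m)%:C *: B.

(* With X = A^(-1/2) B A^(-1/2), the operators [L_tsallis] and [L_log] are
   A^(1/2) l(X) A^(1/2), where l is the chord on [m, M] of (t^p - 1) / p and of
   log t respectively. *)
Definition L_tsallis (R : realType) (H : hilbertType R) (m M p : R)
    (A B : H -> H) : H -> H :=
  (- 1 / (p * (M - m)))%:C *: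
    ((M - m + M * m * (M `^ (p - 1) - m `^ (p - 1)))%:C *: A
     - (M `^ p - m `^ p)%:C *: B).

Definition L_log (R : realType) (H : hilbertType R) (m M : R) (A B : H -> H) :
    H -> H :=
  (1 / (M - m))%:C *:
    ((ln M)%:C *: (B - m%:C *: A) + (ln m)%:C *: (M%:C *: A - B)).

(* Main.v *)
Require Import Defs.
From HB Require Import structures.
From mathcomp Require Import all_boot all_order all_algebra.
From mathcomp Require Import sesquilinear complex.
From mathcomp Require Import all_classical all_reals all_analysis.
From mathcomp Require Import ring lra.
Import Order.TTheory GRing.Theory Num.Theory numFieldNormedType.Exports.
Local Open Scope complex_scope.
Local Open Scope ring_scope.

Set Implicit Arguments.
Unset Strict Implicit.
Unset Printing Implicit Defensive.

(* With X = A^(-1/2) B A^(-1/2), all operators of the theorem have the form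
   A^(1/2) h(X) A^(1/2), and m <= X <= M. Since congruence by A^(1/2) preserves
   positivity, the inequalities reduce to scalar ones on [m, M] for
   f(t) = (t^p - 1) / p, respectively log t (the case p = 0). There f''(t) is
   (p - 1) t^(p-2), so f minus its chord plus (1-p)/2 c^(p-2) (t - m)(t - M),
   which vanishes at both ends, is concave for c = M and convex for c = m.

   The functional calculus rests on the positivity of r(T), for T self-adjoint
   and r a real polynomial that is nonnegative on the spectrum. If the infimum l
   of the numerical range of r(T) were negative, r(T) - l would be nonnegative
   and not bounded below; factoring r - l over the complex numbers, some T - z
   would not be bounded below either, so z would be a real point of the spectrum
   with r(z) = l < 0. The spectrum lies in [a, b] as soon as a <= T <= b, because
   coercive operators are invertible, and the functions involved are Lipschitz on
   [a, b], hence uniform limits of Bernstein polynomials. *)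

(** * Uniform approximation of Lipschitz functions by Bernstein polynomials *)

(** The value at [x] is the mean of [g k] for [k] binomial with parameters [n] and [x], computed by
    conditioning on one trial. With this recursion, linearity, monotonicity and the second moment
    follow by induction, without binomial sums. *)
Fixpoint bernstein (R : comNzRingType) (n : nat) (g : nat -> R) : {poly R} :=
  if n is n'.+1 then
    'X * bernstein n' (g \o succn) + (1 - 'X) * bernstein n' g
  else (g 0%N)%:P.

Lemma bernstein_linear (R : comNzRingType) n (g h : nat -> R) c d x :
  (bernstein n (fun k => c * g k + d * h k)).[x]
  = c * (bernstein n g).[x] + d * (bernstein n h).[x].
Proof.
elim: n g h => [|n IHn] g h /=; rewrite !hornerE //.
by rewrite (IHn (g \o succn) (h \o succn)) IHn; ring.
Qed.

Lemma bernstein_cst (R : comNzRingType) n (c x : R) :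
  (bernstein n (fun=> c)).[x] = c.
Proof.
elim: n => [|n IHn] /=; rewrite !hornerE //.
by rewrite (IHn : (bernstein n ((fun=> c) \o succn)).[x] = c); ring.
Qed.

(** Variance plus squared bias of the binomial law. The centre [c] is arbitrary because a success in
    the conditioned trial shifts it to [c - 1]. *)
Lemma bernstein_sqr_dist (R : comNzRingType) n (c x : R) :
  (bernstein n (fun k => (k%:R - c) ^+ 2)).[x]
  = n%:R * (x * (1 - x)) + (n%:R * x - c) ^+ 2.
Proof.
elim: n c => [|n IHn] c /=; rewrite !hornerE; first by ring.
have -> : ((fun k => (k%:R - c) ^+ 2) \o succn)
          = (fun k => (k%:R - (c - 1)) ^+ 2) :> (nat -> R).
  by apply/funext => k /=; rewrite -natr1; ring.
by rewrite !IHn -natr1 /=; ring.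
Qed.

Lemma ler_bernstein (R : numDomainType) n (g h : nat -> R) x :
  0 <= x -> x <= 1 -> (forall k, (k <= n)%N -> g k <= h k) ->
  (bernstein n g).[x] <= (bernstein n h).[x].
Proof.
move=> x0 x1; elim: n g h => [|n IHn] g h le_gh /=; rewrite !hornerE.
  exact: le_gh.
apply: lerD; apply: ler_wpM2l => //; rewrite ?subr_ge0 //; apply: IHn => k kn.
  exact: le_gh.
by apply: le_gh; rewrite leqW.
Qed.

(* [|x - k/n| <= 1/s + s (x - k/n)^2], and the variance of a binomial law
   divided by n^2 is at most 1/n = 1/s^2. *)
Lemma bernstein_approx (R : realFieldType) (f : R -> R) (L : R) (s : nat) (x : R) :
  0 <= L ->
  (forall u v : R, 0 <= u <= 1 -> 0 <= v <= 1 -> `|f u - f v| <= L * `|u - v|) ->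
  0 <= x <= 1 ->
  `|f x - (bernstein (s.+1 ^ 2) (fun k => f (k%:R / (s.+1 ^ 2)%:R))).[x]|
    <= 2 * L / s.+1%:R.
Proof.
move=> L0 fL /[dup] x01 /andP[x0 x1].
set n := (s.+1 ^ 2)%N; set g := fun k : nat => _; set S : R := s.+1%:R.
have S0 : 0 < S by rewrite ltr0n.
have nS : n%:R = S ^+ 2 by rewrite /n natrX.
have n0 : (0 : R) < n%:R by rewrite nS exprn_gt0.
(* This equals [L * (1 / S + S * (k / n - x) ^ 2)], written so that the second moment about [n x]
   applies. *)
pose h k : R := L / S * 1 + L * S / n%:R ^+ 2 * (k%:R - n%:R * x) ^+ 2.
have le_h k : (k <= n)%N -> `|g k - f x| <= h k.
  move=> kn; have k01 : 0 <= (k%:R / n%:R : R) <= 1.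
    by rewrite divr_ge0 ?ler0n //= ler_pdivrMr // mul1r ler_nat.
  apply: le_trans (fL _ _ k01 x01) _.
  have -> : h k = L * (1 / S + S * (k%:R / n%:R - x) ^+ 2).
    by rewrite /h; field; rewrite !gt_eqF.
  apply: ler_wpM2l => //; set d := _ - x.
  have : 0 <= (`|d| * S - 1) ^+ 2 by exact: sqr_ge0.
  rewrite -(real_normK (num_real d)) -subr_ge0.
  have -> : 1 / S + S * `|d| ^+ 2 - `|d|
            = ((`|d| * S - 1) ^+ 2 + `|d| * S) / S by field; rewrite gt_eqF.
  by move=> ?; rewrite divr_ge0 ?(ltW S0) // addr_ge0 // mulr_ge0 // ltW.
have Eh : (bernstein n h).[x] <= 2 * L / S.
  rewrite /h (bernstein_linear n (fun=> 1)) bernstein_cst bernstein_sqr_dist nS.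
  have -> : L / S * 1 + L * S / (S ^+ 2) ^+ 2
              * (S ^+ 2 * (x * (1 - x)) + (S ^+ 2 * x - S ^+ 2 * x) ^+ 2)
            = (L / S) * (1 + x * (1 - x)) by field; rewrite gt_eqF.
  have -> : 2 * L / S = L / S * 2 by ring.
  by apply: ler_wpM2l; [rewrite divr_ge0 // ltW|nra].
apply: le_trans Eh.
have dE : (bernstein n (fun k => 1 * g k + (- f x) * 1)).[x]
   = (bernstein n g).[x] - f x.
  by rewrite (bernstein_linear n g (fun=> 1)) bernstein_cst; ring.
rewrite distrC ler_norml -dE; apply/andP; split; last first.
  apply: ler_bernstein => // k kn; apply: le_trans (le_h k kn).
  by rewrite mul1r mulr1 ler_norm.
have -> : - (bernstein n h).[x] = (bernstein n (fun k => (-1) * h k + 0 * 1)).[x].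
  by rewrite (bernstein_linear n h (fun=> 1)); ring.
apply: ler_bernstein => // k kn.
have -> : -1 * h k + 0 * 1 = - h k by ring.
have -> : 1 * g k + - f x * 1 = g k - f x by ring.
have := le_h k kn.
by rewrite ler_norml => /andP[].
Qed.

(** The affine map from [0, 1] onto [a, b] multiplies the Lipschitz constant by [b - a]. Bernstein
    polynomials of order [n.+1 ^ 2] give the rate 1 / (n + 1). *)
Lemma lipschitz_poly_approx (R : realFieldType) (f : R -> R) (a b L : R) :
  a < b -> 0 <= L ->
  (forall u v : R, a <= u <= b -> a <= v <= b -> `|f u - f v| <= L * `|u - v|) ->
  exists q : nat -> {poly R}, forall n t, a <= t <= b ->
    `|f t - (q n).[t]| <= 2 * (L * (b - a)) / n.+1%:R.
Proof.
move=> ab L0 fL; have ba0 : 0 < b - a by rewrite subr_gt0.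
pose h u := f (a + (b - a) * u).
exists (fun n => bernstein (n.+1 ^ 2) (fun k => h (k%:R / (n.+1 ^ 2)%:R))
                 \Po ((b - a)^-1 *: ('X - a%:P))) => n t /andP[at_ tb].
rewrite horner_comp hornerZ hornerXsubC; set u := _ * _.
have tE : t = a + (b - a) * u by rewrite /u; field; rewrite gt_eqF.
rewrite {1}tE -/(h u); apply: bernstein_approx => [|v w /andP[v0 v1] /andP[w0 w1]|].
- by rewrite mulr_ge0 // ltW.
- have /le_trans -> // : `|h v - h w| <= L * `|a + (b - a) * v - (a + (b - a) * w)|.
    by apply: fL; apply/andP; split; nra.
  have -> : a + (b - a) * v - (a + (b - a) * w) = (b - a) * (v - w) by ring.
  by rewrite normrM (gtr0_norm ba0) mulrA.
- by rewrite /u; apply/andP; split;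
    [rewrite mulr_ge0 ?subr_ge0 // invr_ge0 ltW
    |rewrite mulrC ler_pdivrMr // mul1r lerD2r].
Qed.

(** * Consequences of the mean value theorem *)

Lemma MVT_subsegment (R : realType) (f df : R -> R) (a b u v : R) :
  (forall t : R, a <= t <= b -> is_derive t 1 f (df t)) ->
  a <= u -> u <= v -> v <= b ->
  exists2 c, u <= c <= v & f v - f u = df c * (v - u).
Proof.
move=> fdf au uv vb.
have in_ab c : c \in `[u, v] -> a <= c <= b.
  rewrite in_itv /= => /andP[uc cv].
  by rewrite (le_trans au uc) (le_trans cv vb).
have [c cuv||c cuv fE] := @MVT_segment _ f df u v uv.
- by apply/fdf/in_ab/subset_itv_oo_cc.
- apply: derivable_within_continuous => c cuv.
  by have [] := fdf _ (in_ab _ cuv).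
- by exists c => //; move: cuv; rewrite in_itv.
Qed.

Lemma bounded_derive_lipschitz (R : realType) (f df : R -> R) (a b L : R) :
  (forall t : R, a <= t <= b -> is_derive t 1 f (df t)) ->
  (forall t : R, a <= t <= b -> `|df t| <= L) ->
  forall u v : R, a <= u <= b -> a <= v <= b -> `|f u - f v| <= L * `|u - v|.
Proof.
move=> fdf dfL u v; wlog uv : u v / u < v => [H|/andP[au ub] /andP[av vb]].
  move=> uab vab; have [uv|vu|->] := ltgtP u v; first exact: H.
  by rewrite distrC (distrC u); exact: H.
  by rewrite !subrr normr0 mulr0.
have [c /andP[uc cv] fE] := MVT_subsegment fdf au (ltW uv) vb.
rewrite distrC fE normrM (distrC u); apply: ler_wpM2r => //.
by apply: dfL; rewrite (le_trans au uc) (le_trans cv vb).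
Qed.

Lemma derive_le0_nincr (R : realType) (f df : R -> R) (a b : R) :
  (forall t : R, a <= t <= b -> is_derive t 1 f (df t)) ->
  (forall t : R, a <= t <= b -> df t <= 0) ->
  forall u v : R, a <= u -> u <= v -> v <= b -> f v <= f u.
Proof.
move=> fdf df0 u v au uv vb.
have [c /andP[uc cv] fE] := MVT_subsegment fdf au uv vb.
rewrite -subr_le0 fE mulr_le0_ge0 ?subr_ge0 // df0 //.
by rewrite (le_trans au uc) (le_trans cv vb).
Qed.

(** Concavity: if [g t < 0], the mean value theorem gives a negative slope in [a, t] and a positive
    one in [t, b], although [dg] is nonincreasing. *)
Lemma nincr_derive_ge0 (R : realType) (g dg : R -> R) (a b : R) :
  (forall t : R, a <= t <= b -> is_derive t 1 g (dg t)) ->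
  (forall s t : R, a <= s -> s <= t -> t <= b -> dg t <= dg s) ->
  g a = 0 -> g b = 0 -> forall t : R, a <= t <= b -> 0 <= g t.
Proof.
move=> gdg dgN ga gb t /andP[at_ tb].
have [c /andP[ac ct]] := MVT_subsegment gdg (lexx a) at_ tb.
have [d /andP[td db]] := MVT_subsegment gdg at_ tb (lexx b).
rewrite ga gb subr0 sub0r => gE1 gE2.
have dcd : dg d <= dg c by apply: dgN => //; exact: le_trans td.
rewrite leNgt; apply/negP => gt0.
have at0 : a < t.
  by rewrite lt_neqAle at_ andbT; apply: contraTneq gt0 => <-; rewrite ga ltxx.
have tb0 : t < b.
  by rewrite lt_neqAle tb andbT; apply: contraTneq gt0 => ->; rewrite gb ltxx.
have : dg c < 0 by rewrite -(pmulr_llt0 _ (_ : 0 < t - a)) -?gE2 ?subr_gt0.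
have : 0 < dg d by rewrite -(pmulr_lgt0 _ (_ : 0 < b - t)) -?gE1 ?oppr_gt0 ?subr_gt0.
by lra.
Qed.

(** * Monotonicity of real powers *)

Lemma powR_le_anti (R : realType) (r x y : R) :
  r <= 0 -> 0 < x -> x <= y -> y `^ r <= x `^ r.
Proof.
move=> r0 x0 xy; have y0 := lt_le_trans x0 xy.
rewrite -[r]opprK !(powRN _ (- r)) lef_pV2 ?posrE ?powR_gt0 //.
by apply: ge0_ler_powR; rewrite ?nnegrE ?oppr_ge0 // ltW.
Qed.

(** The power is monotone, so one of its end values is a bound; adding the other one, which is
    nonnegative, gives a bound that does not depend on the sign of [r]. *)
Lemma powR_le_ends (R : realType) (r a b t : R) :
  0 < a -> a <= t <= b -> t `^ r <= a `^ r + b `^ r.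
Proof.
move=> a0 /andP[at_ tb]; have [r0|r0] := leP 0 r.
  apply: (@le_trans _ _ (b `^ r)); last by rewrite lerDr powR_ge0.
  by apply: ge0_ler_powR; rewrite ?nnegrE //; lra.
apply: (@le_trans _ _ (a `^ r)); last by rewrite lerDl powR_ge0.
exact: powR_le_anti (ltW r0) a0 at_.
Qed.

(** * Quadratic corrections of the chord *)

Definition chord (R : realType) (f : R -> R) (a b t : R) : R :=
  (f a * (b - t) + f b * (t - a)) / (b - a).

Section chord_bounds.
Context {R : realType}.
Variables (f : R -> R) (p m M : R).
Hypotheses (p_le1 : p <= 1) (m_gt0 : 0 < m) (m_lt_M : m < M).
Hypothesis f_derive : forall t : R, 0 < t -> is_derive t 1 f (t `^ (p - 1)).

(** The second derivative of [err c] is [(1 - p) * (c ^ (p - 2) - t ^ (p - 2))], of constant sign on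
    [m, M] when [c] is an end of the segment. *)
Let err c t : R := (f t - chord f m M t)
  + (1 - p) / 2 * c `^ (p - 2) * ((t - m) * (t - M)).

Let derr c t : R := (t `^ (p - 1) - (f M - f m) / (M - m))
  + (1 - p) / 2 * c `^ (p - 2) * ((t - m) + (t - M)).

Let p2_le0 : p - 2 <= 0.
Proof. by rewrite subr_le0 (le_trans p_le1) // ler1n. Qed.

Let err_derive c (t : R) : 0 < t -> is_derive t 1 (err c) (derr c t).
Proof.
move=> t0; have ft := f_derive t0.
rewrite /err /chord /derr; apply: is_derive_eq.
rewrite /GRing.scale /=; field; rewrite subr_eq0 gt_eqF //.
Qed.

Let derr_derive c (t : R) : 0 < t ->
  is_derive t 1 (derr c) ((1 - p) * (c `^ (p - 2) - t `^ (p - 2))).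
Proof.
move=> t0; have := is_derive1_powR (p - 1) t0.
have -> : p - 1 - 1 = p - 2 by ring.
move=> pt; rewrite /derr; apply: is_derive_eq.
by rewrite /GRing.scale /=; field.
Qed.

Let err_m c : err c m = 0.
Proof. by rewrite /err /chord; field; rewrite subr_eq0 gt_eqF. Qed.

Let err_M c : err c M = 0.
Proof. by rewrite /err /chord; field; rewrite subr_eq0 gt_eqF. Qed.

(** At [c = M] the power [c ^ (p - 2)] is least on [m, M], so [err M] is concave; it vanishes at
    both ends, hence is nonnegative. *)
Lemma chord_lower_bound (t : R) : m <= t <= M ->
  chord f m M t - (1 - p) / 2 * M `^ (p - 2) * ((t - m) * (t - M)) <= f t.
Proof.
move=> tmM; rewrite -subr_ge0.
suff: 0 <= err M t by rewrite /err; lra.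
apply: (nincr_derive_ge0 _ _ (err_m _) (err_M _) tmM) => [s /andP[ms _]|].
  exact/err_derive/(lt_le_trans m_gt0).
apply: derive_le0_nincr => s /andP[ms sM].
  exact/derr_derive/(lt_le_trans m_gt0).
rewrite mulr_ge0_le0 ?subr_ge0 // subr_le0.
exact/powR_le_anti/sM/(lt_le_trans m_gt0 ms).
Qed.

(** At [c = m] the power is largest and [err m] is convex, so the concavity argument applies to its
    opposite. *)
Lemma chord_upper_bound (t : R) : m <= t <= M ->
  f t <= chord f m M t - (1 - p) / 2 * m `^ (p - 2) * ((t - m) * (t - M)).
Proof.
move=> tmM; rewrite -subr_ge0.
suff: 0 <= - err m t by rewrite /err; lra.
apply: (@nincr_derive_ge0 _ (fun t => - err m t) (fun t => - derr m t)) tmM.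
- move=> s /andP[ms _].
  by have ? := err_derive m (lt_le_trans m_gt0 ms); apply: is_deriveN.
- apply: (@derive_le0_nincr _ (fun t => - derr m t)) => s /andP[ms sM].
    have ? := derr_derive m (lt_le_trans m_gt0 ms); exact: is_deriveN.
  by rewrite oppr_le0 mulr_ge0 ?subr_ge0 //; apply: powR_le_anti.
- by rewrite err_m oppr0.
- by rewrite err_M oppr0.
Qed.

End chord_bounds.

(** * The real inner product of a complex Hilbert space *)

Section real_inner.
Local Open Scope classical_set_scope.
Context {R : realType} {H : hilbertType R}.
Implicit Types x y z : H.

(* The real part of the inner product: a real inner product for which
   complex-linear symmetric operators are exactly the self-adjoint ones. *)
Definition rin x y : R := complex.Re (inner x y).

Definition hnorm x : R := Num.sqrt (rin x x).

Lemma innerJ x y : inner y x = ((inner x y)^*)%C.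
Proof. by rewrite hermC expr0 mul1r. Qed.

Lemma rinC x y : rin x y = rin y x.
Proof. by rewrite /rin innerJ; case: (inner y x). Qed.

Lemma rinDl x y z : rin (x + y) z = rin x z + rin y z.
Proof. by rewrite /rin linearDl raddfD. Qed.

Lemma rinDr x y z : rin z (x + y) = rin z x + rin z y.
Proof. by rewrite rinC rinDl !(rinC z). Qed.

Lemma rin0l x : rin 0 x = 0.
Proof. by rewrite /rin linear0l. Qed.

Lemma rin0r x : rin x 0 = 0.
Proof. by rewrite rinC rin0l. Qed.

Lemma rinNl x z : rin (- x) z = - rin x z.
Proof. by apply/eqP; rewrite -addr_eq0 -rinDl addNr rin0l. Qed.

Lemma rinNr x z : rin z (- x) = - rin z x.
Proof. by rewrite rinC rinNl rinC. Qed.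

Lemma innerZl (c : R[i]) x z : inner (c *: x) z = c * inner x z.
Proof. by rewrite linearZl_LR. Qed.

Lemma rinZl (a : R) x z : rin (a%:C *: x) z = a * rin x z.
Proof. by rewrite /rin innerZl; case: (inner x z) => u v /=; rewrite mul0r subr0. Qed.

Lemma rinZr (a : R) x z : rin z (a%:C *: x) = a * rin z x.
Proof. by rewrite rinC rinZl rinC. Qed.

Lemma innerDl x y z : inner (x + y) z = inner x z + inner y z.
Proof. by rewrite linearDl. Qed.

Lemma innerDr x y z : inner z (x + y) = inner z x + inner z y.
Proof. by rewrite innerJ innerDl rmorphD /= -!innerJ. Qed.

(** Recovers imaginary parts from [rin]; through it, symmetry for [rin] forces the numbers
    [inner (T x) x] to be real. *)
Lemma rin_il x z : rin ('i%C *: x) z = - complex.Im (inner x z).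
Proof.
by rewrite /rin innerZl; case: (inner x z) => u v /=; rewrite mul0r mul1r sub0r.
Qed.

Definition rinE := (rinDl, rinDr, rinNl, rinNr, rinZl, rinZr).

Lemma inner_self x : inner x x = (rin x x)%:C.
Proof.
have /ger0_Im : 0 <= inner x x by rewrite -sqr_norm_inner exprn_ge0.
by rewrite /rin; case: (inner x x) => u v /= ->.
Qed.

Lemma rin_ge0 x : 0 <= rin x x.
Proof. by rewrite -ler0c -inner_self -sqr_norm_inner exprn_ge0. Qed.

Lemma normE x : `|x| = (hnorm x)%:C.
Proof.
apply/eqP; rewrite -(@eqrXn2 _ 2) ?ler0c ?sqrtr_ge0 //.
by rewrite sqr_norm_inner inner_self -rmorphXn /= sqr_sqrtr ?rin_ge0.
Qed.

Lemma hnorm_ge0 x : 0 <= hnorm x.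
Proof. exact: sqrtr_ge0. Qed.

Lemma sqr_hnorm x : hnorm x ^+ 2 = rin x x.
Proof. by rewrite sqr_sqrtr ?rin_ge0. Qed.

Lemma rin_eq0 x : rin x x = 0 -> x = 0.
Proof.
move=> x0; apply/eqP; rewrite -normr_eq0 normE /hnorm x0.
by rewrite sqrtr0.
Qed.

Lemma rin_gt0 x : x != 0 -> 0 < rin x x.
Proof.
by move=> x0; rewrite lt_neqAle rin_ge0 andbT eq_sym; apply: contra_neq x0 => /rin_eq0.
Qed.

Lemma ler_hnormD x y : hnorm (x + y) <= hnorm x + hnorm y.
Proof. by rewrite -lecR rmorphD /= -!normE ler_normD. Qed.

Lemma hnorm_opp x : hnorm (- x) = hnorm x.
Proof. by rewrite /hnorm !rinE opprK. Qed.

Lemma hnorm_scale (a : R) x : hnorm (a%:C *: x) = `|a| * hnorm x.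
Proof. by rewrite /hnorm !rinE mulrA -expr2 sqrtrM ?sqr_ge0 // sqrtr_sqr. Qed.

Lemma hnorm_scaleC (a : R[i]) :
  exists2 r : R, 0 <= r & forall x, hnorm (a *: x) = r * hnorm x.
Proof.
have aE : `|a| = (complex.Re `|a|)%:C by rewrite RRe_real ?normr_real.
exists (complex.Re `|a|); first by rewrite -ler0c -aE.
by move=> x; apply: complexI; rewrite rmorphM /= -!normE -aE normrZ.
Qed.

Lemma hnorm_distC x y : hnorm (x - y) = hnorm (y - x).
Proof. by rewrite -hnorm_opp opprB. Qed.

Lemma hnorm_triangle y x z : hnorm (x - z) <= hnorm (x - y) + hnorm (y - z).
Proof. by rewrite -[x - z](subrKA y) ler_hnormD. Qed.

Lemma hnorm_le_eps x : (forall e : R, 0 < e -> hnorm x <= e) -> x = 0.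
Proof.
move=> xe; apply: rin_eq0; rewrite -sqr_hnorm.
suff -> : hnorm x = 0 by rewrite expr0n.
apply/eqP; rewrite -[_ == _]negbK; apply/negP => x0.
have xp : 0 < hnorm x by rewrite lt_neqAle hnorm_ge0 andbT eq_sym.
by have := xe (hnorm x / 2) (divr_gt0 xp (ltr0Sn R 1)); lra.
Qed.

Lemma hnorm_zero : hnorm 0 = 0.
Proof. by rewrite /hnorm rin0l sqrtr0. Qed.

Lemma ler_hnorm (c : R) x y : 0 <= c ->
  (hnorm x <= c * hnorm y) = (rin x x <= c ^+ 2 * rin y y).
Proof.
move=> c0; rewrite -!sqr_hnorm -exprMn ler_sqr ?nnegrE ?hnorm_ge0 //.
by rewrite mulr_ge0 ?hnorm_ge0.
Qed.

Lemma ler_norm_hnorm (c : R) x y :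
  (`|x| <= c%:C * `|y|) = (hnorm x <= c * hnorm y).
Proof. by rewrite !normE -rmorphM lecR. Qed.

(** The squared norm of [<y, y> x - <x, y> y] is [<y, y>] times the difference of the two squared
    sides. *)
Lemma rin_cauchy_schwarz x y : `|rin x y| <= hnorm x * hnorm y.
Proof.
rewrite -ler_sqr ?nnegrE ?mulr_ge0 ?hnorm_ge0 //.
rewrite real_normK ?num_real // exprMn !sqr_hnorm.
have [->|y0] := eqVneq y 0; first by rewrite !rin0r mulr0 expr0n.
have := rin_ge0 ((rin y y)%:C *: x - (rin x y)%:C *: y).
rewrite !rinE (rinC y x) => q0.
have : 0 <= rin y y * (rin x x * rin y y - rin x y ^+ 2) by lra.
by rewrite pmulr_rge0 ?rin_gt0 // subr_ge0.
Qed.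

Lemma rin_sqrD_le x y : rin (x + y) (x + y) <= 2 * rin x x + 2 * rin y y.
Proof. by have := rin_ge0 (x - y); rewrite !rinE; lra. Qed.

Lemma rin_young x y : rin x y <= (rin x x + rin y y) / 2.
Proof. by have := rin_ge0 (x - y); rewrite !rinE (rinC y x); lra. Qed.

(** Completeness of [H] restated for the real norm: the tolerances of the original norm are positive
    elements of [R[i]], that is, positive reals. *)
Lemma hcauchy_cvg (u : nat -> H) :
  (forall e : R, 0 < e -> exists N, forall n, (N <= n)%N -> hnorm (u n - u N) <= e) ->
  exists l, forall e : R, 0 < e -> \forall n \near \oo, hnorm (u n - l) <= e.
Proof.
move=> uC; have cvu : cvg (u @ \oo).
  apply/cauchy_cvgP/cauchyP => e e0.
  have [e' e'0 ->] : exists2 e', 0 < e' & e = e'%:C.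
    by move: e0; rewrite ltcE; case: e => a b /= /andP[/eqP-> a0]; exists a.
  have [N uN] := uC (e' / 2) (divr_gt0 e'0 (ltr0Sn _ 1)).
  exists (u N), N => // n /= Nn; rewrite -ball_normE /=.
  rewrite normE ltcR hnorm_distC (le_lt_trans (uN _ Nn)) //; lra.
exists (lim (u @ \oo)) => e e0; have e0C : 0 < e%:C by rewrite ltcR.
have /cvgrPdist_le /(_ _ e0C) := cvu.
by apply: filterS => n; rewrite normE lecR hnorm_distC.
Qed.

End real_inner.

(** * Polynomials in a bounded operator *)

Section operators.
Context {R : realType} {H : hilbertType R}.
Implicit Types (S T : H -> H) (x y z : H) (p q : {poly R}) (P Q : {poly R[i]}).

(** Gives access to the general lemmas on linear maps for a bare function known to be linear. *)
Lemma linear_bundle T : linear T -> exists f : {linear H -> H}, T = f.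
Proof.
move=> Tlin; pose i := GRing.isLinear.Build _ _ _ _ T Tlin.
by exists (HB.pack T i : {linear H -> H}).
Qed.

(** Here and in [bounded_below] the norms are squared, so that estimates stay polynomial in the
    inner products and no square root appears. *)
Definition rbounded T := exists2 C : R, 0 <= C &
  forall x, rin (T x) (T x) <= C * rin x x.

Definition bounded_below T := exists2 c : R, 0 < c &
  forall x, c * rin x x <= rin (T x) (T x).

Definition rsymmetric T := forall x y, rin (T x) y = rin x (T y).

Lemma rbounded_hnorm F : rbounded F ->
  exists2 L : R, 0 <= L & forall x, hnorm (F x) <= L * hnorm x.
Proof.
move=> [C C0 FC]; exists (Num.sqrt C) => [|x]; first exact: sqrtr_ge0.
by rewrite ler_hnorm ?sqrtr_ge0 // sqr_sqrtr.
Qed.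

Lemma bounded_opP T : bounded_op T <-> linear T /\ rbounded T.
Proof.
split=> -[Tlin]; split=> //.
  have [c Tc] := b; exists (`|c| ^+ 2); first exact: sqr_ge0.
  move=> x; rewrite -ler_hnorm //; have := Tc x; rewrite ler_norm_hnorm.
  by move=> /le_trans; apply; rewrite ler_wpM2r ?hnorm_ge0 ?ler_norm.
have [C C0 TC] := b; exists (Num.sqrt C) => x.
by rewrite ler_norm_hnorm ler_hnorm ?sqrtr_ge0 // sqr_sqrtr.
Qed.

(** Polarization: the form is real at [x + y], so the imaginary parts of [<T x, y>] and [<T y, x>]
    cancel; replacing [x] by [i x] turns this into an equality of real parts. *)
Lemma positive_op_rsymmetric T : linear T -> positive_op T -> rsymmetric T.
Proof.
move=> /linear_bundle[f ->] f0.
have ImT x : complex.Im (inner (f x) x) = 0 by exact: ger0_Im.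
have ImD x y : complex.Im (inner (f x) y) + complex.Im (inner (f y) x) = 0.
  have := ImT (x + y); rewrite (linearD f) !(innerDl, innerDr) !raddfD /=.
  by rewrite !ImT add0r addr0 addrC.
move=> x y; rewrite -[rin x _]rinC; apply/eqP; rewrite -subr_eq0.
have := ImD ('i%C *: x) y; rewrite [f _]linearZ_LR innerZl.
rewrite [inner (f y) _]innerJ innerZl (innerJ (f y) x) /rin.
by case: (inner (f x) y) (inner (f y) x) => a b [c d] /= E; apply/eqP; lra.
Qed.

(** Conversely, symmetry at the pair [i x], [x] makes the imaginary part of [<T x, x>] equal to its
    opposite. *)
Lemma positive_opP T : linear T ->
  positive_op T <-> rsymmetric T /\ forall x, 0 <= rin (T x) x.
Proof.
move=> Tlin; split=> [T0|[Tsym T0] x].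
  split; first exact: positive_op_rsymmetric.
  by move=> x; have := T0 x; rewrite lecE => /andP[].
rewrite lecE T0 andbT; apply/eqP => /=; apply: oppr_inj.
have [f fE] := linear_bundle Tlin; rewrite fE in Tsym *.
have := Tsym ('i%C *: x) x; rewrite [f _]linearZ_LR !rin_il (innerJ (f x) x) /=.
by case: (inner (f x) x) => a b /=; lra.
Qed.

Lemma bounded_op_comp S T : bounded_op S -> bounded_op T -> bounded_op (S \o T).
Proof.
move=> /bounded_opP[Sl [C C0 SC]] /bounded_opP[Tl [D D0 TD]]; apply/bounded_opP.
split; first by move=> a x y /=; rewrite Tl Sl.
exists (C * D); first exact: mulr_ge0.
by move=> x /=; rewrite (le_trans (SC _)) // -mulrA ler_wpM2l.
Qed.

Lemma bounded_opD S T : bounded_op S -> bounded_op T -> bounded_op (S + T).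
Proof.
move=> /bounded_opP[Sl [C C0 SC]] /bounded_opP[Tl [D D0 TD]]; apply/bounded_opP.
split; first by move=> a x y; rewrite !fctE Sl Tl scalerDr addrACA.
exists (2 * C + 2 * D); first by lra.
move=> x; rewrite !fctE (le_trans (rin_sqrD_le _ _)) //.
by have := SC x; have := TD x; lra.
Qed.

Lemma bounded_opZ (a : R) T : bounded_op T -> bounded_op (a%:C *: T).
Proof.
move=> /bounded_opP[Tl [C C0 TC]]; apply/bounded_opP.
split.
  by move=> b x y; rewrite !fctE Tl scalerDr !scalerA mulrC.
exists (a ^+ 2 * C); first by rewrite mulr_ge0 ?sqr_ge0.
move=> x; rewrite !fctE !rinE; have := TC x; have := sqr_ge0 a.
by move=> ? ?; rewrite mulrA -expr2 -mulrA ler_wpM2l.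
Qed.

Lemma bounded_op_id : bounded_op (id : H -> H).
Proof.
by apply/bounded_opP; split => //; exists 1 => // x; rewrite mul1r.
Qed.

Lemma bounded_opN T : bounded_op T -> bounded_op (- T).
Proof.
have -> : - T = (-1)%:C *: T by apply/funext=> x; rewrite !fctE rmorphN1 scaleN1r.
exact: bounded_opZ.
Qed.

Lemma bounded_op0 : bounded_op (0 : H -> H).
Proof.
have -> : 0 = 0%:C *: id :> (H -> H).
  by apply/funext=> x; rewrite !fctE scale0r.
exact/bounded_opZ/bounded_op_id.
Qed.

Lemma bounded_op_iter T n : bounded_op T -> bounded_op (iter n T).
Proof.
move=> bT; elim: n => [|n IHn]; first exact: bounded_op_id.
exact: (bounded_op_comp bT IHn).
Qed.

Lemma bounded_op_poly p T : bounded_op T -> bounded_op (op_poly p T).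
Proof.
move=> bT; apply: (big_ind _ bounded_op0 bounded_opD) => i _.
exact/bounded_opZ/bounded_op_iter.
Qed.

Lemma op_polyE p T x :
  op_poly p T x = \sum_(i < size p) (p`_i)%:C *: iter i T x.
Proof. by rewrite /op_poly fct_sumE. Qed.

Lemma rsymmetric_op_poly p T : rsymmetric T -> rsymmetric (op_poly p T).
Proof.
move=> Tsym x y; rewrite !op_polyE.
apply: (big_ind2 (fun u v => rin u y = rin x v)).
- by rewrite rin0l rin0r.
- by move=> u v u' v' E E'; rewrite rinDl rinDr E E'.
- move=> i _; rewrite rinZl rinZr; congr (_ * _).
  by elim: (nat_of_ord i) y => //= n IHn y; rewrite Tsym IHn -iterSr.
Qed.

(* Evaluation at an operator of a polynomial with complex coefficients, which
   unlike a real one is a product of linear factors. *)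
Definition cpoly_op P T x : H := \sum_(i < size P) P`_i *: iter i T x.

Lemma cpoly_opE n P T x : (size P <= n)%N ->
  cpoly_op P T x = \sum_(i < n) P`_i *: iter i T x.
Proof.
move=> Pn; rewrite /cpoly_op (big_ord_widen _ (fun i => P`_i *: iter i T x) Pn).
rewrite [RHS](bigID (fun i : 'I_n => (i < size P)%N)) /= [X in _ + X]big1 ?addr0 //.
by move=> i; rewrite -leqNgt => Pi; rewrite nth_default ?scale0r.
Qed.

Lemma op_polyC p T x : op_poly p T x = cpoly_op (map_poly (real_complex R) p) T x.
Proof.
rewrite op_polyE /cpoly_op size_map_poly.
by apply: eq_bigr => i _; rewrite coef_map.
Qed.

Lemma cpoly_opD P Q T x : cpoly_op (P + Q) T x = cpoly_op P T x + cpoly_op Q T x.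
Proof.
pose n := maxn (size P) (size Q).
rewrite !(@cpoly_opE n) ?leq_maxl ?leq_maxr ?size_polyD // -big_split.
by apply: eq_bigr => i _; rewrite coefD scalerDl.
Qed.

Lemma cpoly_opZ a P T x : cpoly_op (a *: P) T x = a *: cpoly_op P T x.
Proof.
rewrite !(@cpoly_opE (size P)) ?size_scale_leq // scaler_sumr.
by apply: eq_bigr => i _; rewrite coefZ scalerA.
Qed.

Lemma cpoly_op_cst a T x : cpoly_op a%:P T x = a *: x.
Proof.
by rewrite (@cpoly_opE 1) ?size_polyC_leq1 // big_ord_recl big_ord0 addr0 coefC.
Qed.

Lemma cpoly_opMX P T x : cpoly_op (P * 'X) T x = cpoly_op P T (T x).
Proof.
rewrite (@cpoly_opE (size P).+1) ?size_mulX_leq //; last first.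
  by have [->|P0] := eqVneq P 0; rewrite ?mul0r ?size_poly0 // size_mulX.
rewrite big_ord_recl coefMX scale0r add0r.
by apply: eq_bigr => i _; rewrite coefMX /= -iterSr.
Qed.

Lemma cpoly_op_comm P T x : linear T -> cpoly_op P T (T x) = T (cpoly_op P T x).
Proof.
move=> /linear_bundle[f ->]; rewrite /cpoly_op (linear_sum f).
by apply: eq_bigr => i _; rewrite -iterSr /= [f (_ *: _)]linearZ_LR.
Qed.

Lemma cpoly_opM P Q T x : linear T ->
  cpoly_op (P * Q) T x = cpoly_op P T (cpoly_op Q T x).
Proof.
move=> Tlin; elim/poly_ind: P x => [|P c IHP] x.
  by rewrite mul0r -polyC0 !cpoly_op_cst !scale0r.
rewrite mulrDl !cpoly_opD mul_polyC cpoly_opZ cpoly_op_cst cpoly_opMX.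
by rewrite mulrAC cpoly_opMX IHP cpoly_op_comm.
Qed.

Lemma op_polyD p q T : op_poly (p + q) T = op_poly p T + op_poly q T.
Proof. by apply/funext => x; rewrite !fctE !op_polyC rmorphD cpoly_opD. Qed.

Lemma op_polyZ (a : R) p T : op_poly (a *: p) T = a%:C *: op_poly p T.
Proof. by apply/funext => x; rewrite !fctE !op_polyC map_polyZ cpoly_opZ. Qed.

Lemma op_poly_cst (a : R) T : op_poly a%:P T = a%:C *: id.
Proof. by apply/funext => x; rewrite op_polyC map_polyC cpoly_op_cst. Qed.

Lemma cpoly_opX T x : cpoly_op 'X T x = T x.
Proof. by rewrite -['X]mul1r cpoly_opMX cpoly_op_cst scale1r. Qed.

Lemma op_polyX T : op_poly 'X T = T.
Proof. by apply/funext => x; rewrite op_polyC map_polyX cpoly_opX. Qed.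

Lemma op_polyM p q T : linear T ->
  op_poly (p * q) T = op_poly p T \o op_poly q T.
Proof.
by move=> Tlin; apply/funext => x; rewrite /= !op_polyC rmorphM cpoly_opM.
Qed.

Lemma bounded_below_prod (s : seq R[i]) T : linear T ->
  (forall z : R[i], z \in s -> bounded_below (T - z *: id)) ->
  bounded_below (cpoly_op (\prod_(z <- s) ('X - z%:P)) T).
Proof.
move=> Tlin; elim: s => [_|z s IHs Ts].
  exists 1 => // x; rewrite big_nil -polyC1 cpoly_op_cst scale1r mul1r.
  exact: lexx.
have [c c0 Tc] := Ts z (mem_head _ _).
have [|d d0 Td] := IHs; first by move=> w ws; apply: Ts; rewrite inE ws orbT.
exists (c * d) => [|x]; first exact: mulr_gt0.
rewrite big_cons cpoly_opM // cpoly_opD -polyCN cpoly_op_cst.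
rewrite cpoly_opX scaleNr.
by apply: le_trans (Tc _); rewrite -mulrA ler_wpM2l ?(ltW c0).
Qed.

Lemma invertible_bounded_below T : invertible_op T -> bounded_below T.
Proof.
move=> [S [/bounded_opP[_ [C C0 SC]] ST _]].
(* The bound [C] on the inverse may be 0, hence the inverse of [C + 1] as constant. *)
have C1 : 0 < C + 1 by lra.
exists (C + 1)^-1; rewrite ?invr_gt0 // => x.
rewrite mulrC ler_pdivrMr // mulrC.
have /(congr1 (fun f => f x)) /= Sx := ST.
by have := SC (T x); rewrite Sx; have := rin_ge0 (T x); lra.
Qed.

Lemma rin_op_bound T : rbounded T ->
  exists2 D : R, 0 < D & forall x, `|rin (T x) x| <= D * rin x x.
Proof.
move=> [C C0 TC]; exists ((C + 1) / 2) => [|x]; first by lra.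
rewrite ler_norml; apply/andP; split.
  rewrite lerNl -rinNr; have := rin_young (T x) (- x); have := TC x.
  by rewrite !rinE; lra.
by have := rin_young (T x) x; have := TC x; lra.
Qed.

(* Nonnegativity of the form at [x - T x / D] is the required bound. *)
Lemma positive_op_rbound T : linear T -> rbounded T -> rsymmetric T ->
  (forall x, 0 <= rin (T x) x) ->
  exists2 D : R, 0 < D & forall x, rin (T x) (T x) <= D * rin (T x) x.
Proof.
move=> Tlin Tb Tsym T0; have [D D0 TD] := rin_op_bound Tb.
exists D => // x; have [f fE] := linear_bundle Tlin; rewrite fE in Tb Tsym T0 TD *.
have := T0 (x - (D^-1)%:C *: f x).
have -> : f (x - (D^-1)%:C *: f x) = f x - (D^-1)%:C *: f (f x).
  by rewrite (linearB f) [f (_ *: _)]linearZ_LR.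
have := TD (f x); rewrite ler_norml => /andP[_]; rewrite !rinE.
rewrite (Tsym (f x) x).
set a := rin (f x) x; set b := rin (f x) (f x); set c := rin (f (f x)) (f x).
move=> cD H0; have {}H0 : 0 <= a - 2 / D * b + c / D ^+ 2.
  by move: H0; congr (0 <= _); field; rewrite gt_eqF.
have : c / D ^+ 2 <= b / D.
  rewrite ler_pdivrMr ?exprn_gt0 // (_ : b / D * D ^+ 2 = D * b) //.
  by field; rewrite gt_eqF.
move=> cb; have : b / D <= a.
  by move: H0 cb; rewrite (_ : 2 / D * b = 2 * (b / D)); [lra|ring].
by rewrite ler_pdivrMr // mulrC.
Qed.

(** For [z = a + i b], the cross term vanishes because [<(T - a) x, x>] is real, so that [|(T - z)
    x|^2 = |(T - a) x|^2 + b^2 |x|^2]. *)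
Lemma nonreal_bounded_below T (z : R[i]) : linear T -> rsymmetric T ->
  complex.Im z != 0 -> bounded_below (T - z *: id).
Proof.
case: z => a b /= Tlin Tsym b0; exists (b ^+ 2) => [|x].
  by rewrite lt_neqAle eq_sym sqrf_eq0 b0 sqr_ge0.
have -> : (T - (a +i* b) *: id) x = (T x - a%:C *: x) - b%:C *: ('i%C *: x).
  rewrite -[LHS]/(T x - (a +i* b) *: x) scalerA -addrA -opprD -scalerDl.
  congr (_ - _ *: _); apply/eqP; rewrite eq_complex /=.
  by rewrite !(mulr0, mul0r, mulr1, subr0, addr0, add0r) !eqxx.
have Tx : complex.Im (inner (T x) x) = 0.
  apply: oppr_inj; have := Tsym ('i%C *: x) x; have [f ->] := linear_bundle Tlin.
  rewrite [f _]linearZ_LR !rin_il (innerJ (f x) x) /=.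
  by case: (inner (f x) x) => u v /=; lra.
have xx : complex.Im (inner x x) = 0 by rewrite inner_self.
have ii : rin ('i%C *: x) ('i%C *: x) = rin x x.
  rewrite rin_il innerJ innerZl inner_self /=; ring.
rewrite !rinE ii !(rinC _ ('i%C *: x)) !rin_il (innerJ (T x)) /=.
have := rin_ge0 (T x - a%:C *: x); rewrite !rinE xx.
rewrite (_ : complex.Im (inner (T x) x)^*%C = 0); last first.
  by move: Tx; case: (inner (T x) x) => u v /= ->; rewrite oppr0.
lra.
Qed.

End operators.

(** * Polynomials that are nonnegative on the spectrum give positive operators *)

Section positivity.
Context {R : realType} {H : hilbertType R}.
Implicit Types (S T : H -> H) (x y z : H) (p q : {poly R}).
Local Open Scope classical_set_scope.

(* If [q] has no zero on the spectrum, the linear factors of [q] are bounded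
   below at [T]: those with a nonreal root always are. *)
Lemma op_poly_bounded_below T q : linear T -> rsymmetric T -> q != 0 ->
  (forall t : R, spectrum T t%:C -> q.[t] != 0) -> bounded_below (op_poly q T).
Proof.
move=> Tlin Tsym q0 qT; pose Q := map_poly (real_complex R) q.
have [s Qs] := closed_field_poly_normal Q.
have Q0 : lead_coef Q != 0 by rewrite lead_coef_eq0 map_poly_eq0.
have [c c0 sc] : bounded_below (cpoly_op (\prod_(z <- s) ('X - z%:P)) T).
  apply: bounded_below_prod => // -[a b] zs.
  have [b0|b0] := eqVneq b 0; last exact: nonreal_bounded_below.
  apply: invertible_bounded_below; apply: contrapT => aT.
  have zE : a +i* b = a%:C by rewrite b0.
  rewrite zE in zs aT; have := qT a aT.
  apply/negP/negPn.
  rewrite -(fmorph_eq0 (real_complex R)) -horner_map -/Q Qs hornerZ mulf_eq0.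
  by rewrite -/(root _ _) root_prod_XsubC zs orbT.
have [D D0 QD] : exists2 D : R, 0 < D &
    forall x, rin (lead_coef Q *: x) (lead_coef Q *: x) = D * rin x x.
  exists (complex.Re (lead_coef Q) ^+ 2 + complex.Im (lead_coef Q) ^+ 2).
    rewrite -ltcR add_Re2_Im2 exprn_gt0 // normr_gt0 //.
  move=> x; rewrite /rin innerZl innerJ innerZl inner_self.
  by case: (lead_coef Q) => u v /=; ring.
exists (D * c) => [|x]; first exact: mulr_gt0.
by rewrite op_polyC -/Q Qs cpoly_opZ QD -mulrA ler_wpM2l // ltW.
Qed.

Let normalize x : x != 0 -> exists y, rin y y = 1 /\
  forall T, linear T -> rin (T x) x = rin x x * rin (T y) y.
Proof.
move=> x0; have n0 : 0 < hnorm x by rewrite sqrtr_gt0 rin_gt0.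
exists ((hnorm x)^-1%:C *: x); split=> [|T /linear_bundle[f ->]].
  by rewrite !rinE -sqr_hnorm; field; rewrite gt_eqF.
by rewrite [f (_ *: _)]linearZ_LR !rinE -sqr_hnorm; field; rewrite gt_eqF.
Qed.

Let nonconstant_op_poly_ge0 T p : bounded_op T -> rsymmetric T ->
  (1 < size p)%N -> (forall t : R, spectrum T t%:C -> 0 <= p.[t]) ->
  forall x, 0 <= rin (op_poly p T x) x.
Proof.
move=> bT Tsym p1 pT x0; rewrite leNgt; apply/negP => neg.
have [Tlin _] := bT.
have /bounded_opP[Ylin Yb] := bounded_op_poly p bT.
have [B B0 YB] := rin_op_bound Yb.
pose E := [set rin (op_poly p T x) x | x in [set x | rin x x = 1]].
have x00 : x0 != 0 by apply: contraTneq neg => ->; rewrite rin0r ltxx.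
have [y0 [y01 x0E]] := normalize x00.
have Ey0 : E (rin (op_poly p T y0) y0) by exists y0.
have Ei : has_inf E.
  split; first by exists (rin (op_poly p T y0) y0).
  exists (- B) => _ [y /= y1 <-]; have := YB y.
  by rewrite y1 mulr1 ler_norml => /andP[].
set l := inf E; have l0 : l < 0.
  apply: le_lt_trans (ge_inf Ei.2 Ey0) _.
  by rewrite -(pmulr_rlt0 _ (rin_gt0 x00)) -x0E.
pose q := p - l%:P.
have qE x : op_poly q T x = op_poly p T x - l%:C *: x.
  rewrite /q op_polyD -polyCN op_poly_cst rmorphN.
  by rewrite -[LHS]/(op_poly p T x + (- l%:C) *: x) scaleNr.
(* A nonconstant [p] differs from the constant [l], whatever the infimum is. *)
have q0 : q != 0.
  by rewrite subr_eq0; apply: contraTneq p1 => ->; rewrite -leqNgt size_polyC_leq1.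
have /bounded_opP[qlin qb] := bounded_op_poly q bT.
have qsym := rsymmetric_op_poly q Tsym.
have q_ge0 x : 0 <= rin (op_poly q T x) x.
  have [->|/normalize[y [y1 xE]]] := eqVneq x 0; first by rewrite rin0r.
  rewrite xE // mulr_ge0 ?rin_ge0 // qE !rinE y1 mulr1 subr_ge0.
  by apply: (ge_inf Ei.2); exists y.
have [D D0 qD] := positive_op_rbound qlin qb qsym q_ge0.
have [|c c0 qc] := op_poly_bounded_below Tlin Tsym q0.
  by move=> t /pT pt; rewrite !hornerE gt_eqF // subr_gt0 (lt_le_trans l0).
(* On unit vectors [c <= |q(T) y|^2 <= D <q(T) y, y>], so the numerical range of [p(T)] lies above
   [l + c / D], against the choice of [l]. *)
have : l + c / D <= l.
  apply: lb_le_inf Ei.1 _ => _ [y /= y1 <-].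
  have := le_trans (qc y) (qD y); rewrite qE !rinE y1 !mulr1.
  by rewrite -lerBrDl ler_pdivrMr // mulrC.
by apply/negP; rewrite -ltNge ltrDl divr_gt0.
Qed.

Theorem op_poly_ge0 T p : bounded_op T -> rsymmetric T ->
  (forall t : R, spectrum T t%:C -> 0 <= p.[t]) ->
  forall x, 0 <= rin (op_poly p T x) x.
Proof.
move=> bT Tsym pT; have [p1|p1] := ltnP 1 (size p).
  exact: nonconstant_op_poly_ge0.
have pE := size1_polyC p1; rewrite pE in pT *; set c := p`_0 in pT *.
move=> x; rewrite op_poly_cst -[(_ *: _) x]/(c%:C *: x) rinZl.
have [c0|c0] := leP 0 c; first by rewrite mulr_ge0 ?rin_ge0.
(* A constant [c < 0] forces the spectrum to be empty, hence [T >= N] for all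
   [N], which is only possible on the null space. *)
have T0 (t : R) : ~ spectrum T t%:C.
  by move=> /pT; rewrite hornerC leNgt c0.
have /bounded_opP[_ Tb] := bT; have [B B0 TB] := rin_op_bound Tb.
have : 0 <= rin (op_poly ('X - (B + 1)%:P) T x) x.
  by apply: nonconstant_op_poly_ge0 => //; rewrite ?size_XsubC // => t /T0.
rewrite op_polyD op_polyX -polyCN op_poly_cst.
rewrite -[(_ + _) x]/(T x + (- (B + 1))%:C *: x) !rinE => TBx.
have := TB x; rewrite ler_norml => /andP[_ TBx'].
suff -> : rin x x = 0 by rewrite mulr0.
by apply/eqP; rewrite eq_le rin_ge0 andbT; lra.
Qed.

End positivity.

(** * Invertibility of coercive operators and location of the spectrum *)

Section spectrum_bounds.
Context {R : realType} {H : hilbertType R}.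
Implicit Types (S T : H -> H) (x y z : H).
Local Open Scope classical_set_scope.

(* The solution of [T x = y] is the fixed point of [x - t (T x - y)], which is a
   contraction for small [t]. *)
Lemma coercive_surjective T (c : R) : bounded_op T -> 0 < c ->
  (forall x, c * rin x x <= rin (T x) x) -> forall y, exists x, T x = y.
Proof.
move=> /bounded_opP[/linear_bundle[f ->] [C C0 TC]] c0 Tc y {T}.
(* The squared contraction factor is at most [1 - 2 t c + t^2 C]. With [t = c / D] and [C <= D] this
   is at most [r = 1 - c^2 / D]; the summand [c^2] in [D] keeps [r] nonnegative, the summand 1
   leaves a margin. *)
pose D := C + c ^+ 2 + 1; have c2 : 0 < c ^+ 2 by exact: exprn_gt0.
have D0 : 0 < D by rewrite /D; lra.
pose t := c / D; have t0 : 0 < t by exact: divr_gt0.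
pose G x := x - t%:C *: f x.
pose r := 1 - c ^+ 2 / D; have r0 : 0 <= r.
  by rewrite subr_ge0 ler_pdivrMr // mul1r /D; lra.
have r1 : r < 1 by rewrite ltrBlDr ltrDl divr_gt0.
pose k := Num.sqrt r; have k0 : 0 <= k by exact: sqrtr_ge0.
have k1 : k < 1 by rewrite -sqrtr1 ltr_sqrt.
have Gk x : hnorm (G x) <= k * hnorm x.
  rewrite ler_hnorm // sqr_sqrtr // /G !rinE (rinC x).
  have -> : r * rin x x = rin x x - 2 * t * (c * rin x x)
      + t ^+ 2 * (C * rin x x) + t ^+ 2 * ((c ^+ 2 + 1) * rin x x).
    by rewrite /r /t /D; field; rewrite -/D gt_eqF.
  have := ler_wpM2l (ltW t0) (Tc x); have := ler_wpM2l (sqr_ge0 t) (TC x).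
  have : 0 <= t ^+ 2 * ((c ^+ 2 + 1) * rin x x).
    by rewrite mulr_ge0 ?sqr_ge0 // mulr_ge0 ?rin_ge0 //; lra.
  by lra.
pose u n := iter n (fun x => x - t%:C *: (f x - y)) 0.
pose d := hnorm (u 1%N - u 0%N).
have uS n : u n.+2 - u n.+1 = G (u n.+1 - u n).
  have E a b : (a - t%:C *: (f a - y)) - (b - t%:C *: (f b - y)) = G (a - b).
    by rewrite /G (linearB f) opprD addrACA -opprD -scalerBr opprB subrKA.
  exact: E.
have un n : hnorm (u n.+1 - u n) <= d * k ^+ n.
  elim: n => [|n IHn]; first by rewrite expr0 mulr1.
  rewrite uS (le_trans (Gk _)) // exprS mulrCA ler_wpM2l //.
(* Geometric sum of the increments, multiplied by [1 - k] so that the induction involves no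
   division. *)
have unm n m : (1 - k) * hnorm (u (n + m)%N - u n) <= d * k ^+ n * (1 - k ^+ m).
  elim: m => [|m IHm]; first by rewrite addn0 subrr hnorm_zero expr0 subrr !mulr0.
  have := hnorm_triangle (u (n + m)%N) (u (n + m).+1) (u n).
  have := un (n + m)%N; rewrite addnS exprD => h1 h2.
  have h3 : (1 - k) * hnorm (u (n + m).+1 - u n) <= (1 - k) * (d * (k ^+ n * k ^+ m)
      + hnorm (u (n + m)%N - u n)).
    by apply: ler_wpM2l; [rewrite subr_ge0 ltW | lra].
  by rewrite exprS; lra.
have kn (e : R) : 0 < e -> \forall n \near \oo, k ^+ n <= e.
  move=> e0; have /cvgr0Pnorm_le /(_ _ e0) : (GRing.exp k : R ^nat) @ \oo --> 0.
    by apply: cvg_expr; rewrite ger0_norm.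
  by apply: filterS => n; rewrite ger0_norm ?exprn_ge0.
have d0 : 0 <= d by exact: hnorm_ge0.
have [|l ul] := @hcauchy_cvg _ _ u.
  move=> e e0; have k1' : 0 < 1 - k by rewrite subr_gt0.
  have d1 : 0 < d + 1 by lra.
  have [N _ /(_ N (leqnn _)) /= kN] 
    := kn (e * (1 - k) / (d + 1)) (divr_gt0 (mulr_gt0 e0 k1') d1).
  exists N => n Nn; rewrite -(ler_pM2l k1') -(subnKC Nn) (le_trans (unm _ _)) //.
  rewrite ler_pdivlMr // in kN.
  have kN0 : 0 <= k ^+ N by exact: exprn_ge0.
  have km0 : 0 <= k ^+ (n - N) by exact: exprn_ge0.
  have : d * k ^+ N * (1 - k ^+ (n - N)) <= d * k ^+ N * 1.
    by apply: ler_wpM2l; [exact: mulr_ge0|lra].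
  by nra.
(* The distance from [f l] to [y] is at most [|f (l - u n)| + |f (u n) - y|]. The first term is
   small by continuity, the second because [t (f (u n) - y)] is [u n - u n.+1]; each gets
   [e / 2]. *)
exists l; apply/eqP; rewrite -subr_eq0; apply/eqP/hnorm_le_eps => e e0.
have [K K0 fK] : exists2 K : R, 0 <= K & forall x, hnorm (f x) <= K * hnorm x.
  by exists (Num.sqrt C) => // x; rewrite ler_hnorm // sqr_sqrtr.
have K1 : 0 < 2 * (K + 1) by lra.
have d1 : 0 < 2 * (d + 1) by lra.
have e1 : 0 < e / (2 * (K + 1)) by exact: divr_gt0.
have e2 : 0 < t * e / (2 * (d + 1)) by rewrite divr_gt0 // mulr_gt0.
near \oo => n.
have un_l : hnorm (u n - l) <= e / (2 * (K + 1)) by near: n; exact: ul.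
have kn_e : k ^+ n <= t * e / (2 * (d + 1)) by near: n; exact: kn.
apply: le_trans (hnorm_triangle (f (u n)) _ _) _.
rewrite -(linearB f).
have h1 : hnorm (f (l - u n)) <= K * hnorm (u n - l).
  by rewrite hnorm_distC.
have h2 : t * hnorm (f (u n) - y) <= d * k ^+ n.
  apply: le_trans (un n); rewrite -[X in X * _](gtr0_norm t0) -hnorm_scale -hnorm_opp.
  by rewrite [u n.+1]/= -/(u n) addrAC subrr sub0r.
have h3 : d * k ^+ n <= t * (e / 2).
  apply: le_trans (ler_wpM2l d0 kn_e) _.
  have -> : d * (t * e / (2 * (d + 1))) = t * (e / 2) * (d / (d + 1)).
    by field; apply/eqP; lra.
  apply: ler_piMr; first by rewrite mulr_ge0 ?divr_ge0 // ltW.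
  by rewrite ler_pdivrMr ?mul1r; lra.
have h4 : hnorm (f (u n) - y) <= e / 2 by rewrite -(ler_pM2l t0) (le_trans h2).
have h5 : K * hnorm (u n - l) <= e / 2.
  apply: le_trans (ler_wpM2l K0 un_l) _.
  have -> : K * (e / (2 * (K + 1))) = (e / 2) * (K / (K + 1)).
    by field; apply/eqP; lra.
  apply: ler_piMr; first by rewrite divr_ge0 // ltW.
  by rewrite ler_pdivrMr ?mul1r; lra.
lra.
Unshelve. all: by end_near. Qed.

(** Surjectivity provides a right inverse by choice; coercivity makes [T] injective, hence this
    inverse linear and two-sided. *)
Lemma coercive_invertible T (c : R) : bounded_op T -> 0 < c ->
  (forall x, c * rin x x <= rin (T x) x) -> invertible_op T.
Proof.
move=> bT c0 Tc; have [S TS] := choice (coercive_surjective bT c0 Tc).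
have [/linear_bundle[f fE] _] := bT; rewrite {T bT}fE in Tc TS *.
have f_eq0 x : f x = 0 -> x = 0.
  move=> fx; apply: rin_eq0; apply/eqP; rewrite eq_le rin_ge0 andbT.
  by have := Tc x; rewrite fx rin0l pmulr_rle0.
have f_inj x y : f x = f y -> x = y.
  move=> E; apply/eqP; rewrite -subr_eq0; apply/eqP/f_eq0.
  by rewrite (linearB f) E subrr.
exists S; split; last 2 first.
- by apply/funext => x /=; apply: f_inj; rewrite TS.
- exact/funext.
apply/bounded_opP; split=> [a x y|].
  by apply: f_inj; rewrite (linearP f) !TS.
exists (c ^- 2) => [|x]; first by rewrite invr_ge0 sqr_ge0.
rewrite mulrC ler_pdivlMr ?exprn_gt0 // mulrC.
(* Expanding [|c S x - x|^2 >= 0] together with [c |S x|^2 <= <x, S x>] gives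
   [c^2 |S x|^2 <= |x|^2]. *)
have := Tc (S x); rewrite TS; have := rin_ge0 (c%:C *: S x - x); rewrite !rinE.
rewrite (rinC (S x)) => h1 h2; have := ler_wpM2l (ltW c0) h2; lra.
Qed.

Lemma invertible_opN T : linear T -> invertible_op (- T) -> invertible_op T.
Proof.
move=> /linear_bundle[f ->] [S [bS Sf fS]]; exists (S \o -%R); split.
- apply: bounded_op_comp => //; have -> : -%R = - id :> (H -> H) by [].
  exact/bounded_opN/bounded_op_id.
- by apply/funext => x; have /(congr1 (fun g => g x)) := Sf.
- apply/funext => x; have /(congr1 (fun g => g (- x))) /= := fS.
  rewrite -[(- _) _]/(- f (S (- x))) => /oppr_inj; exact.
Qed.

(** For [t < a] the operator [T - t] is coercive with constant [a - t]; for [t > b] its opposite is,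
    with constant [t - b]. *)
Lemma spectrum_itv T (a b : R) : bounded_op T ->
  (forall x, a * rin x x <= rin (T x) x) ->
  (forall x, rin (T x) x <= b * rin x x) ->
  forall t : R, spectrum T t%:C -> a <= t <= b.
Proof.
move=> bT aT Tb t tT; apply/andP; split; rewrite leNgt; apply/negP => t_out; apply: tT.
  apply: (@coercive_invertible _ (a - t)); rewrite ?subr_gt0 //.
    by apply: bounded_opD => //; apply/bounded_opN/bounded_opZ/bounded_op_id.
  move=> x; rewrite -[(_ - _) x]/(T x - t%:C *: x) !rinE.
  by have := aT x; lra.
apply: invertible_opN.
  have [/linear_bundle[f ->] _] := bT => c x y.
  rewrite -[LHS]/(f (c *: x + y) - t%:C *: (c *: x + y)) (linearP f) scalerDr.
  by rewrite opprD addrACA scalerA mulrC -scalerA -scalerBr.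
apply: (@coercive_invertible _ (t - b)); rewrite ?subr_gt0 //.
  by apply/bounded_opN/bounded_opD => //; apply/bounded_opN/bounded_opZ/bounded_op_id.
move=> x; rewrite -[(- _) x]/(- (T x - t%:C *: x)) !rinE.
by have := Tb x; lra.
Qed.

End spectrum_bounds.

(** * Continuous functional calculus *)

Section functional_calculus.
Context {R : realType} {H : hilbertType R}.
Implicit Types (S T F G : H -> H) (x y z : H) (p q : {poly R}) (f g : R -> R).
Local Open Scope classical_set_scope.

Lemma op_cvgP (S : nat -> H -> H) T : op_cvg S T <->
  forall e : R, 0 < e -> \forall n \near \oo, forall x,
    hnorm (S n x - T x) <= e * hnorm x.
Proof.
split=> ST e /ST; apply: filterS => n Sn x; have := Sn x;
  by rewrite ler_norm_hnorm.
Qed.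

Lemma uniform_cvgP (A : set R) (h : nat -> R -> R) f :
  {uniform A, h @ \oo --> f} <->
  forall e : R, 0 < e -> \forall n \near \oo, forall t, A t -> `|f t - h n t| < e.
Proof.
split=> [hf e e0|hf P /uniform_nbhs[E [entE EP]]].
  have := hf [set g : {uniform` A -> R} | forall t, A t -> `|f t - g t| < e]; apply.
  apply/uniform_nbhs; exists [set xy : R * R | `|xy.1 - xy.2| < e]; split => //.
  by rewrite -entourage_ballE; exists e => // -[u v]; rewrite /= -ball_normE.
move: entE; rewrite -entourage_ballE => -[e /= e0 eE].
rewrite /nbhs /=; apply: filterS (hf e e0) => n hn; apply: EP => t /hn ft.
by apply: (eE (f t, h n t)); rewrite /= -ball_normE.
Qed.

Section fixed_operator.
Variable T : H -> H.
Hypotheses (T_bounded : bounded_op T) (T_sym : rsymmetric T).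

Let Tlin : linear T := T_bounded.1.
Let sigma : set R := [set t : R | spectrum T t%:C].

Definition uniform_limit (p : nat -> {poly R}) f :=
  forall e : R, 0 < e -> \forall n \near \oo, forall t, sigma t ->
    `|f t - (p n).[t]| <= e.

Definition operator_limit (p : nat -> {poly R}) F :=
  forall e : R, 0 < e -> \forall n \near \oo, forall x,
    hnorm (op_poly (p n) T x - F x) <= e * hnorm x.

Lemma is_cfcP f F : is_cfc f T F <->
  bounded_op F /\ exists p : nat -> {poly R}, uniform_limit p f /\ operator_limit p F.
Proof.
split=> -[bF [p [pf pF]]]; split=> //; exists p; split.
- move=> e e0; have /uniform_cvgP/(_ _ e0) := pf; apply: filterS => n + t ft.
  by move=> /(_ t ft)/ltW.
- exact/op_cvgP.
- apply/uniform_cvgP => e e0; have := pf (e / 2) (divr_gt0 e0 (ltr0Sn _ 1)).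
  by apply: filterS => n + t ft => /(_ t ft); lra.
- exact/op_cvgP.
Qed.

Lemma op_poly_subE p q x : op_poly (p - q) T x = op_poly p T x - op_poly q T x.
Proof.
by rewrite op_polyD -scaleN1r op_polyZ rmorphN1 -[LHS]/(_ + (-1) *: _) scaleN1r.
Qed.

(** The polynomial [e^2 - p^2] is nonnegative on the spectrum, and [<p(T)^2 x, x> = |p(T) x|^2] by
    symmetry. This control of the norm by values on the spectrum is what makes the calculus
    converge. *)
Lemma hnorm_op_poly p (e : R) : 0 <= e ->
  (forall t, sigma t -> `|p.[t]| <= e) ->
  forall x, hnorm (op_poly p T x) <= e * hnorm x.
Proof.
move=> e0 pe x; rewrite ler_hnorm //.
have : 0 <= rin (op_poly ((e ^+ 2)%:P - p * p) T x) x.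
  apply: op_poly_ge0 => // t /pe pt; rewrite !hornerE -expr2 subr_ge0.
  by rewrite -(real_normK (num_real p.[t])) ler_sqr ?nnegrE.
rewrite op_poly_subE op_polyM // op_poly_cst -[X in X - _]/((e ^+ 2)%:C *: x).
by rewrite !rinE /= (rsymmetric_op_poly p T_sym) subr_ge0.
Qed.

Lemma is_cfc_rsymmetric f F : is_cfc f T F -> rsymmetric F.
Proof.
move=> /is_cfcP[_ [p [_ pF]]] x y; apply/eqP; rewrite -subr_eq0 -normr_eq0.
rewrite eq_le normr_ge0 andbT; apply/ler_addgt0Pl => e e0; rewrite addr0.
pose K := hnorm x * hnorm y; have K0 : 0 <= K by rewrite mulr_ge0 ?hnorm_ge0.
have K1 : 0 < 2 * K + 1 by lra.
near \oo => n.
have pn : forall z, hnorm (op_poly (p n) T z - F z) <= e / (2 * K + 1) * hnorm z.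
  by near: n; apply: pF; exact: divr_gt0.
have sym := rsymmetric_op_poly (p n) T_sym x y.
have -> : rin (F x) y - rin x (F y)
        = rin x (op_poly (p n) T y - F y) - rin (op_poly (p n) T x - F x) y.
  by rewrite !rinE sym; ring.
have h1 := le_trans (rin_cauchy_schwarz _ _) (ler_wpM2l (hnorm_ge0 x) (pn y)).
have h2 := le_trans (rin_cauchy_schwarz _ _) (ler_wpM2r (hnorm_ge0 y) (pn x)).
apply: le_trans (ler_normB _ _) _.
apply: le_trans (lerD h1 h2) _.
have -> : hnorm x * (e / (2 * K + 1) * hnorm y) + e / (2 * K + 1) * hnorm x * hnorm y
     = e * (2 * K / (2 * K + 1)) by rewrite /K; field; rewrite -/K gt_eqF.
by rewrite ler_piMr ?(ltW e0) // ler_pdivrMr // mul1r; lra.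
Unshelve. all: by end_near. Qed.

(** The approximating polynomials may be negative on the spectrum, but [p n + d] is not once [p n]
    is within [d] of [f]; this costs an error of [2 d |x|^2] in all. *)
Lemma is_cfc_ge0 f F : is_cfc f T F -> (forall t, sigma t -> 0 <= f t) ->
  forall x, 0 <= rin (F x) x.
Proof.
move=> /is_cfcP[_ [p [pf pF]]] f0 x; rewrite -oppr_le0.
apply/ler_addgt0Pl => e e0; rewrite addr0.
have n0 := rin_ge0 x; have n1 : 0 < 2 * rin x x + 1 by lra.
have e1 : 0 < e / (2 * rin x x + 1) by exact: divr_gt0.
set d := e / _ in e1.
near \oo => n.
have pn : hnorm (op_poly (p n) T x - F x) <= d * hnorm x.
  by near: n; apply: filterS (pF d e1).
have ptn : forall t, sigma t -> `|f t - (p n).[t]| <= d by near: n; exact: pf.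
have : 0 <= rin (op_poly (p n + d%:P) T x) x.
  apply: op_poly_ge0 => // t st; rewrite !hornerE.
  by have := ptn t st; have := f0 t st; rewrite ler_norml => ? /andP[]; lra.
rewrite op_polyD op_poly_cst -[(_ + _) x]/(op_poly (p n) T x + d%:C *: x) !rinE => h0.
have := le_trans (rin_cauchy_schwarz _ _) (ler_wpM2r (hnorm_ge0 x) pn).
rewrite -mulrA -expr2 sqr_hnorm !rinE ler_norml => /andP[_ h1].
have : d * (2 * rin x x + 1) = e by rewrite /d divfK // gt_eqF.
lra.
Unshelve. all: by end_near. Qed.

Lemma is_cfc_ext f g F : (forall t, sigma t -> f t = g t) ->
  is_cfc f T F -> is_cfc g T F.
Proof.
move=> fg /is_cfcP[bF [p [pf pF]]]; apply/is_cfcP; split=> //; exists p; split=> //.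
by move=> e /pf; apply: filterS => n + t st => /(_ t st); rewrite fg.
Qed.

Lemma is_cfcD f g F G : is_cfc f T F -> is_cfc g T G ->
  is_cfc (fun t => f t + g t) T (F + G).
Proof.
move=> /is_cfcP[bF [p [pf pF]]] /is_cfcP[bG [q [qg qG]]]; apply/is_cfcP.
split; first exact: bounded_opD.
exists (fun n => p n + q n); split=> e e0; have e2 : 0 < e / 2 by lra.
  apply: filterS2 (pf _ e2) (qg _ e2) => n pn qn t st; rewrite hornerD.
  rewrite opprD addrACA (le_trans (ler_normD _ _)) //.
  by have := pn t st; have := qn t st; lra.
apply: filterS2 (pF _ e2) (qG _ e2) => n pn qn x.
rewrite op_polyD -[(F + G) x]/(F x + G x) -[(_ + _) x]/(_ x + _ x).
rewrite opprD addrACA (le_trans (ler_hnormD _ _)) //.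
by have := pn x; have := qn x; lra.
Qed.

Lemma is_cfc_poly p : is_cfc (horner p) T (op_poly p T).
Proof.
apply/is_cfcP; split; first exact: bounded_op_poly.
exists (fun=> p); split=> e e0; apply: nearW => n t *.
  by rewrite subrr normr0 ltW.
by rewrite subrr hnorm_zero mulr_ge0 ?hnorm_ge0 ?ltW.
Qed.

Lemma is_cfcZ (a : R) f F : is_cfc f T F ->
  is_cfc (fun t => a * f t) T (a%:C *: F).
Proof.
move=> /is_cfcP[bF [p [pf pF]]]; apply/is_cfcP.
split; first exact: bounded_opZ.
have a1 : 0 < `|a| + 1 by have := normr_ge0 a; lra.
have ae (e : R) : 0 < e -> `|a| * (e / (`|a| + 1)) <= e.
  move=> e0; rewrite mulrCA ler_piMr ?(ltW e0) // ler_pdivrMr // mul1r; lra.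
exists (fun n => a *: p n); split=> e e0; have e2 := divr_gt0 e0 a1.
  apply: filterS (pf _ e2) => n pn t st; rewrite hornerZ -mulrBr normrM.
  exact: le_trans (ler_wpM2l (normr_ge0 a) (pn t st)) (ae _ e0).
apply: filterS (pF _ e2) => n pn x.
rewrite op_polyZ -[(_ *: F) x]/(a%:C *: F x).
rewrite -[(_ *: op_poly _ _) x]/(a%:C *: op_poly (p n) T x).
rewrite -scalerBr hnorm_scale (le_trans (ler_wpM2l (normr_ge0 a) (pn x))) //.
by rewrite mulrA ler_wpM2r ?hnorm_ge0 ?ae.
Qed.

(** The difference [D] is a value of the zero function, so [D] and [-D] are both positive; a
    positive operator with zero form vanishes. *)
Lemma is_cfc_unique f F G : is_cfc f T F -> is_cfc f T G -> F = G.
Proof.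
move=> cF cG; pose D := F + (-1)%:C *: G.
have cD : is_cfc (fun t => f t + -1 * f t) T D by exact/is_cfcD/is_cfcZ.
have cD' : is_cfc (fun t => -1 * (f t + -1 * f t)) T ((-1)%:C *: D) by exact: is_cfcZ.
have D0 x : 0 <= rin (D x) x by apply: (is_cfc_ge0 cD) => t _; lra.
have D0' x : rin (D x) x <= 0.
  have : 0 <= rin (((-1)%:C *: D) x) x by apply: (is_cfc_ge0 cD') => t _; lra.
  by rewrite rinZl; lra.
have /bounded_opP[Dlin Db] : bounded_op D by have [] := cD.
have [B B0 DB] := positive_op_rbound Dlin Db (is_cfc_rsymmetric cD) D0.
apply/funext => x; apply/eqP; rewrite -subr_eq0; apply/eqP/rin_eq0/eqP.
rewrite eq_le rin_ge0 andbT.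
have -> : F x - G x = D x by rewrite -[D x]/(F x + (-1)%:C *: G x) rmorphN1 scaleN1r.
by apply: le_trans (DB x) _; rewrite mulr_ge0_le0 ?(ltW B0).
Qed.

(** Both for functions and for operators, [f g - p q = (f - p) g + p (g - q)]. The bound [K] on the
    spectrum keeps [p n], and hence the norm of [p n] at [T], below [K + 1]. *)
Lemma is_cfcM f g F G (K : R) : is_cfc f T F -> is_cfc g T G ->
  (forall t : R, spectrum T t%:C -> `|f t| <= K /\ `|g t| <= K) -> 0 <= K ->
  is_cfc (fun t => f t * g t) T (F \o G).
Proof.
move=> cF cG fgK K0; have [bF [p [pf pF]]] := (is_cfcP _ _).1 cF.
have [bG [q [qg qG]]] := (is_cfcP _ _).1 cG.
have [_ /rbounded_hnorm[L L0 GL]] := (bounded_opP _).1 bG.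
apply/is_cfcP; split; first exact: bounded_op_comp.
(* One constant for both estimates: the error is [d (2 K + 1)] for functions and [d (K + 1 + L)] for
   operators. *)
pose N := 2 * K + 1 + L; have N0 : 0 < N by rewrite /N; lra.
exists (fun n => p n * q n).
have d_spec (e : R) : 0 < e -> exists d : R, [/\ 0 < d, d <= 1 & d * N <= e].
  move=> e0; exists (Num.min 1 (e / N)); split.
  - by rewrite lt_min ltr01 divr_gt0.
  - by rewrite ge_min lexx.
  - by rewrite -ler_pdivlMr // ge_min lexx orbT.
have pK d t : `|f t - (p d).[t]| <= 1 -> spectrum T t%:C -> `|(p d).[t]| <= K + 1.
  by move=> h /fgK[fK _]; have := ler_normB (f t) (f t - (p d).[t]); rewrite subKr; lra.
split=> e /d_spec[d [d0 d1 dN]].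
  apply: filterS2 (pf _ d0) (qg _ d0) => n pn qn t st; rewrite hornerM.
  have [_ gK] := fgK t st; have pn' := pn t st; have qn' := qn t st.
  have pK' := pK n t (le_trans pn' d1) st.
  have -> : f t * g t - (p n).[t] * (q n).[t]
     = (f t - (p n).[t]) * g t + (p n).[t] * (g t - (q n).[t]) by ring.
  apply: le_trans (ler_normD _ _) _; rewrite !normrM.
  have := ler_pM (normr_ge0 _) (normr_ge0 _) pn' gK.
  have := ler_pM (normr_ge0 _) (normr_ge0 _) pK' qn'.
  have := mulr_ge0 (ltW d0) L0.
  by move: dN; rewrite /N; lra.
apply: filterS3 (pf _ d0) (pF _ d0) (qG _ d0) => n pn pFn qn x.
rewrite op_polyM // /=.
have [/linear_bundle[P PE] _] := bounded_op_poly (p n) T_bounded.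
have PK : forall z, hnorm (op_poly (p n) T z) <= (K + 1) * hnorm z.
  apply: hnorm_op_poly => //; first by lra.
  by move=> t st; apply: pK => //; exact: le_trans (pn t st) d1.
apply: le_trans (hnorm_triangle (op_poly (p n) T (G x)) _ _) _.
have := pFn (G x); have := ler_wpM2l (ltW d0) (GL x).
have := PK (op_poly (q n) T x - G x); rewrite PE (linearB P) -!PE.
have K1 : 0 <= K + 1 by lra.
have := ler_wpM2l K1 (qn x); have := ler_wpM2r (hnorm_ge0 x) dN.
have := mulr_ge0 (mulr_ge0 (ltW d0) K0) (hnorm_ge0 x).
rewrite /N; lra.
Qed.

(** Uniform convergence on the spectrum makes the operators [p n] at [T] Cauchy in norm. The
    pointwise limits given by completeness form [F], and linearity and boundedness pass to the
    limit. *)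
Lemma is_cfc_exists f (C : R) (p : nat -> {poly R}) : 0 <= C ->
  (forall n (t : R), spectrum T t%:C -> `|f t - (p n).[t]| <= C / n.+1%:R) ->
  exists F, is_cfc f T F.
Proof.
move=> C0 pf.
have P_diff n m x : (n <= m)%N ->
    hnorm (op_poly (p m) T x - op_poly (p n) T x) <= 2 * C / n.+1%:R * hnorm x.
  move=> nm; rewrite -op_poly_subE; apply: hnorm_op_poly => //.
    by rewrite divr_ge0 ?mulr_ge0.
  move=> t st; rewrite hornerD hornerN.
  have -> : (p m).[t] - (p n).[t] = (f t - (p n).[t]) - (f t - (p m).[t]) by ring.
  apply: le_trans (ler_normB _ _) _.
  have -> : 2 * C / n.+1%:R = C / n.+1%:R + C / n.+1%:R by ring.
  apply: lerD (pf n t st) (le_trans (pf m t st) _).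
  by apply: ler_wpM2l => //; rewrite lef_pV2 ?posrE ?ltr0n // ler_nat.
have small (e K : R) : 0 < e -> 0 <= K ->
    \forall n \near \oo, K / n.+1%:R <= e.
  move=> e0 K0; have K1 : 0 < K + 1 by lra.
  have := @cvg_harmonic R; move=> /cvgr0Pnorm_le /(_ _ (divr_gt0 e0 K1)).
  apply: filterS => n; rewrite /harmonic /= ger0_norm ?invr_ge0 ?ler0n //.
  have : 0 <= n.+1%:R^-1 :> R by rewrite invr_ge0.
  by rewrite ler_pdivlMr //; move: (_^-1) => v; lra.
have cvgP x : exists l, forall e : R, 0 < e ->
    \forall n \near \oo, hnorm (op_poly (p n) T x - l) <= e.
  apply: hcauchy_cvg => e e0.
  have K0 : 0 <= 2 * C * hnorm x by rewrite !mulr_ge0 ?hnorm_ge0.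
  have [N _ /(_ N (leqnn _)) /= NN] := small e _ e0 K0.
  exists N => n Nn; apply: le_trans (P_diff _ _ _ Nn) _.
  by rewrite mulrAC.
have [F PF] := choice cvgP.
(* The bound in [P_diff] does not depend on [m], so letting [m] grow gives convergence in norm with
   a rate. *)
have PF_le n x : hnorm (op_poly (p n) T x - F x) <= 2 * C / n.+1%:R * hnorm x.
  apply/ler_addgt0Pr => e e0; near \oo => m.
  have mF : hnorm (op_poly (p m) T x - F x) <= e by near: m; exact: PF.
  have nm : (n <= m)%N by near: m; exists n.
  apply: le_trans (hnorm_triangle (op_poly (p m) T x) _ _) _.
  by rewrite hnorm_distC lerD // P_diff.
exists F; apply/is_cfcP; split; last first.
  exists p; split=> e e0.
    by apply: filterS (small e _ e0 C0) => n Cn t st; exact: le_trans (pf n t st) Cn.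
  have C2 : 0 <= 2 * C by lra.
  apply: filterS (small e _ e0 C2) => n Cn x; apply: le_trans (PF_le n x) _.
  by rewrite ler_wpM2r ?hnorm_ge0.
apply/bounded_opP; split.
  move=> a x y; apply/eqP; rewrite -subr_eq0; apply/eqP/hnorm_le_eps => e e0.
  have [r r0 aE] := @hnorm_scaleC _ H a.
  pose K := 2 * C * (hnorm (a *: x + y) + (r * hnorm x + hnorm y)).
  have K0 : 0 <= K by rewrite !mulr_ge0 ?addr_ge0 ?mulr_ge0 ?hnorm_ge0.
  near \oo => n; apply: (@le_trans _ _ (K / n.+1%:R)); last by near: n; exact: small.
  have [/linear_bundle[P PE] _] := bounded_op_poly (p n) T_bounded.
  have h1 := PF_le n (a *: x + y); have h2 := PF_le n x; have h3 := PF_le n y.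
  rewrite PE (linearP P) -!PE in h1.
  have h2' := ler_wpM2l r0 h2; rewrite -aE in h2'.
  have t1 := hnorm_triangle (a *: op_poly (p n) T x + op_poly (p n) T y)
    (F (a *: x + y)) (a *: F x + F y).
  have t2 := ler_hnormD (a *: (op_poly (p n) T x - F x)) (op_poly (p n) T y - F y).
  rewrite scalerBr addrACA -opprD -scalerBr in t2.
  rewrite hnorm_distC in h1.
  apply: le_trans t1 _; move: h1 h2' h3 t2; rewrite /K.
  by move: (n.+1%:R^-1) => v; lra.
have [_ [D D0 PD]] := (bounded_opP _).1 (bounded_op_poly (p 0%N) T_bounded).
(* [F] is compared with the polynomial of index 0, where the rate is [2 * C / 1]. *)
exists (2 * D + 2 * (2 * C / 1) ^+ 2) => [|x].
  by rewrite addr_ge0 ?mulr_ge0 ?sqr_ge0.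
have h := PF_le 0%N x; rewrite ler_hnorm ?divr_ge0 ?mulr_ge0 // in h.
pose P0 := op_poly (p 0%N) T.
have -> : F x = P0 x + - (P0 x - F x) by rewrite opprB addrC subrK.
apply: le_trans (rin_sqrD_le _ _) _.
by rewrite !(rinNl, rinNr (_ - _)) opprK; have := PD x; rewrite -/P0 in h *; lra.
Unshelve. all: by end_near. Qed.

(** Existence excludes the default value 0 of [cfc]. *)
Lemma cfcP f : (exists F, is_cfc f T F) -> is_cfc f T (cfc f T).
Proof. by move=> [F cF]; exact: (xgetPex 0 (ex_intro _ F cF)). Qed.

Lemma is_cfc_lipschitz f (a b L : R) : a < b -> 0 <= L ->
  (forall t : R, spectrum T t%:C -> a <= t <= b) ->
  (forall u v : R, a <= u <= b -> a <= v <= b -> `|f u - f v| <= L * `|u - v|) ->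
  is_cfc f T (cfc f T).
Proof.
move=> ab L0 Tab fL; apply: cfcP.
have [q fq] := lipschitz_poly_approx ab L0 fL.
apply: (@is_cfc_exists _ (2 * (L * (b - a))) q).
  by rewrite !mulr_ge0 // subr_ge0 ltW.
by move=> n t /Tab; exact: fq.
Qed.

End fixed_operator.
End functional_calculus.

(** * Powers and logarithm of an operator with positive lower bound *)

Section power_and_log.
Context {R : realType} {H : hilbertType R}.
Variables (T : H -> H) (a b : R).
Hypotheses (T_bounded : bounded_op T) (T_sym : rsymmetric T).
Hypotheses (a_gt0 : 0 < a) (a_lt_b : a < b).
Hypothesis aT : forall x, a * rin x x <= rin (T x) x.
Hypothesis Tb : forall x, rin (T x) x <= b * rin x x.

Let Tab := spectrum_itv T_bounded aT Tb.

Lemma is_cfc_pow (r : R) : is_cfc (fun t => t `^ r) T (op_pow T r).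
Proof.
(* The constant bounds the derivative [r t^(r - 1)] on [a, b], whatever the sign of [r - 1]. *)
apply: (@is_cfc_lipschitz _ _ _ T_bounded T_sym _ a b
  (`|r| * (a `^ (r - 1) + b `^ (r - 1)))) => //.
  by rewrite mulr_ge0 // addr_ge0 // powR_ge0.
apply: (@bounded_derive_lipschitz _ _ (fun t => r * t `^ (r - 1))) => t tab.
  by apply: is_derive1_powR; case/andP: tab => at_ _; exact: lt_le_trans at_.
rewrite normrM ler_wpM2l // (ger0_norm (powR_ge0 _ _)).
exact: powR_le_ends.
Qed.

Lemma is_cfc_log : is_cfc (@ln R) T (op_log T).
Proof.
apply: (@is_cfc_lipschitz _ _ _ T_bounded T_sym _ a b a^-1) => //.
  by rewrite invr_ge0 ltW.
apply: (@bounded_derive_lipschitz _ _ (fun t => t^-1)) => t /andP[at_ tb].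
  by apply: is_derive1_ln; exact: lt_le_trans at_.
have t0 := lt_le_trans a_gt0 at_.
by rewrite gtr0_norm ?invr_gt0 // lef_pV2.
Qed.

Lemma is_cfc_id : is_cfc id T T.
Proof.
rewrite -[X in is_cfc _ _ X]op_polyX.
by apply: is_cfc_ext (is_cfc_poly T_bounded _) => t _; rewrite hornerX.
Qed.

Lemma is_cfc_one : is_cfc (fun=> 1) T id.
Proof.
have E : id = op_poly 1%:P T.
  by rewrite op_poly_cst; apply/funext => x; rewrite -[RHS]/(1%:C *: x) scale1r.
rewrite [X in is_cfc _ _ X]E.
by apply: is_cfc_ext (is_cfc_poly T_bounded _) => t _; rewrite hornerC.
Qed.

(** Stated through [is_cfc] so that uniqueness compares the product directly with [id] and with
    [T]. *)
Lemma op_powD (r s : R) : is_cfc (fun t => t `^ (r + s)) T (op_pow T r \o op_pow T s).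
Proof.
pose K := (a `^ r + b `^ r) + (a `^ s + b `^ s).
have end_ge0 (u : R) : 0 <= a `^ u + b `^ u by rewrite addr_ge0 // powR_ge0.
have K0 : 0 <= K by rewrite addr_ge0.
have rK := is_cfcM T_bounded T_sym (is_cfc_pow r) (is_cfc_pow s) _ K0.
apply: is_cfc_ext (rK _) => t /Tab tab.
  rewrite powRD //; apply/implyP => _.
  by case/andP: tab => /(lt_le_trans a_gt0)/gt_eqF->.
rewrite !(ger0_norm (powR_ge0 _ _)); split;
  apply: le_trans (powR_le_ends _ a_gt0 tab) _.
  by rewrite lerDl.
by rewrite lerDr.
Qed.

Lemma op_pow_inv (r : R) : op_pow T r \o op_pow T (- r) = id.
Proof.
apply: (is_cfc_unique T_bounded T_sym (op_powD _ _)).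
by apply: is_cfc_ext is_cfc_one => t _; rewrite subrr powRr0.
Qed.

Lemma op_pow_half_sqr : op_pow T 2^-1 \o op_pow T 2^-1 = T.
Proof.
apply: (is_cfc_unique T_bounded T_sym (op_powD _ _)).
apply: is_cfc_ext is_cfc_id => t /Tab /andP[at_ _].
have -> : 2^-1 + 2^-1 = 1 :> R by field.
by rewrite powRr1 // (le_trans (ltW a_gt0)).
Qed.

End power_and_log.

(** Invertibility gives [c |x|^2 <= |A x|^2] and positivity gives [|A x|^2 <= D <A x, x>], whence
    the lower bound [c / D]. Adding it to [B] makes the upper bound strictly larger. *)
Lemma strictly_positive_bounds (R : realType) (H : hilbertType R) (A : H -> H) :
  bounded_op A -> strictly_positive_op A ->
  exists a b : R, [/\ 0 < a, a < b, (forall x, a * rin x x <= rin (A x) x)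
    & forall x, rin (A x) x <= b * rin x x].
Proof.
move=> /bounded_opP[Alin Ab] [/(positive_opP Alin)[Asym A0] Ainv].
have [c c0 cA] := invertible_bounded_below Ainv.
have [D D0 AD] := positive_op_rbound Alin Ab Asym A0.
have [B B0 AB] := rin_op_bound Ab.
exists (c / D), (c / D + B); split => [|||x]; rewrite ?divr_gt0 ?ltrDl //.
  move=> x; rewrite mulrAC ler_pdivrMr // [X in _ <= X]mulrC.
  exact: le_trans (cA x) (AD x).
rewrite mulrDl; have := AB x; rewrite ler_norml => /andP[_ h].
by apply: le_trans h _; rewrite lerDr mulr_ge0 ?rin_ge0 // divr_ge0 ?ltW.
Qed.

(** * Congruence by the square root *)

Section congruence.
Context {R : realType} {H : hilbertType R}.
Variable F : H -> H.
Hypotheses (F_bounded : bounded_op F) (F_sym : rsymmetric F).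

Definition congr_op (S : H -> H) : H -> H := F \o S \o F.

Let Flin : linear F := F_bounded.1.

Lemma congr_opD (S T : H -> H) : congr_op (S + T) = congr_op S + congr_op T.
Proof.
have [f fE] := linear_bundle Flin; apply/funext => x; rewrite /congr_op fE.
by rewrite -[LHS]/(f (S (f x) + T (f x))) linearD.
Qed.

Lemma congr_opZ (a : R) (S : H -> H) :
  congr_op (a%:C *: S) = a%:C *: congr_op S.
Proof.
have [f fE] := linear_bundle Flin; apply/funext => x; rewrite /congr_op fE.
by rewrite -[LHS]/(f (a%:C *: S (f x))) linearZ_LR.
Qed.

(** The difference on the left has the shape that [is_cfcD] and [is_cfcZ] produce. *)
Lemma congr_opB (S T : H -> H) :
  congr_op (S + (-1)%:C *: T) = congr_op S - congr_op T.
Proof. by rewrite congr_opD congr_opZ rmorphN1 scaleN1r. Qed.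

Lemma positive_congr_op S : bounded_op S -> rsymmetric S ->
  (forall x, 0 <= rin (S x) x) -> positive_op (congr_op S).
Proof.
move=> [Slin _] Ssym S0.
apply/positive_opP; first by move=> a x y; rewrite /congr_op /= Flin Slin Flin.
split=> [x y|x]; rewrite /congr_op /= F_sym; last exact: S0.
by rewrite Ssym F_sym.
Qed.

End congruence.

(** * The operator X = A^(-1/2) B A^(-1/2) and its bounds *)

Section ratio.
Context {R : realType} {H : hilbertType R}.
Variables (A B : H -> H) (m M : R).
Hypotheses (A_bounded : bounded_op A) (A_strictly_pos : strictly_positive_op A).
Hypotheses (B_bounded : bounded_op B) (B_pos : positive_op B).
Hypotheses (m_gt0 : 0 < m) (m_lt_M : m < M).
Hypotheses (mA_le_B : loewner_le (m%:C *: A) B).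
Hypotheses (B_le_MA : loewner_le B (M%:C *: A)).

Let Alin : linear A := A_bounded.1.
Let A_sym : rsymmetric A := positive_op_rsymmetric Alin A_strictly_pos.1.
Let B_sym : rsymmetric B := positive_op_rsymmetric B_bounded.1 B_pos.

Let X := op_ratio A B.
Let F := op_pow A 2^-1.
Let G := op_pow A (- 2^-1).

Let half_power : [/\ bounded_op F, rsymmetric F & F \o F = A]
  /\ [/\ bounded_op G, rsymmetric G, F \o G = id & G \o F = id].
Proof.
have [a [b [a0 ab aA Ab]]] := strictly_positive_bounds A_bounded A_strictly_pos.
have cF := is_cfc_pow A_bounded A_sym a0 ab aA Ab.
have inv := op_pow_inv A_bounded A_sym a0 ab aA Ab.
split; split.
- by have [] := cF 2^-1.
- exact: (is_cfc_rsymmetric A_sym (cF _)).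
- exact: op_pow_half_sqr A_bounded A_sym a0 ab aA Ab.
- by have [] := cF (- 2^-1).
- exact: (is_cfc_rsymmetric A_sym (cF _)).
- exact: inv.
- by have := inv (- 2^-1); rewrite opprK.
Qed.

Lemma op_sqrt_bounded : bounded_op F. Proof. by case: half_power => -[]. Qed.
Let F_sym : rsymmetric F. Proof. by case: half_power => -[]. Qed.
Let G_sym : rsymmetric G. Proof. by case: half_power => _ []. Qed.

Lemma op_ratio_bounded : bounded_op X.
Proof. case: half_power => _ [bG _ _ _].
exact: (bounded_op_comp (bounded_op_comp bG B_bounded) bG). Qed.

Lemma op_ratio_sym : rsymmetric X.
Proof. by move=> x y; rewrite /X /op_ratio /= -/G G_sym B_sym G_sym. Qed.

Lemma congr_op_id : congr_op F id = A.
Proof. by case: half_power => -[]. Qed.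

Lemma congr_op_ratio : congr_op F X = B.
Proof.
case: half_power => _ [_ _ FG GF]; apply/funext => x.
rewrite /congr_op /X /op_ratio /= -/G.
have /(congr1 (fun f => f x)) /= -> := GF.
by have /(congr1 (fun f => f (B x))) /= -> := FG.
Qed.

(** Since [A = F F] and [F G = id], the form of [A] at [G x] is [|F G x|^2 = |x|^2]. Testing the
    Loewner hypotheses at [G x] thus bounds [X] by [m] and [M]. *)
Let rin_A_G x : rin (A (G x)) (G x) = rin x x.
Proof.
have [[_ _ FF] [_ _ FG _]] := half_power.
have /(congr1 (fun f => f (G x))) /= <- := FF.
by rewrite F_sym; have /(congr1 (fun f => f x)) /= -> := FG.
Qed.

Lemma op_ratio_lower x : m * rin x x <= rin (X x) x.
Proof.
rewrite /X /op_ratio /= -/G G_sym -rin_A_G -rinZl.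
have /(_ (G x)) := mA_le_B; rewrite lecE => /andP[_] /=.
by rewrite -[complex.Re _]/(rin (B (G x) - m%:C *: A (G x)) (G x)) rinDl rinNl subr_ge0.
Qed.

Lemma op_ratio_upper x : rin (X x) x <= M * rin x x.
Proof.
rewrite /X /op_ratio /= -/G G_sym -rin_A_G -rinZl.
have /(_ (G x)) := B_le_MA; rewrite lecE => /andP[_] /=.
by rewrite -[complex.Re _]/(rin (M%:C *: A (G x) - B (G x)) (G x)) rinDl rinNl subr_ge0.
Qed.

Lemma op_ratio_spectrum (t : R) : spectrum X t%:C -> m <= t <= M.
Proof.
apply: spectrum_itv; [exact: op_ratio_bounded|exact: op_ratio_lower|].
exact: op_ratio_upper.
Qed.

Lemma is_cfc_ratio_pow (r : R) : is_cfc (fun t => t `^ r) X (op_pow X r).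
Proof.
exact: is_cfc_pow op_ratio_bounded op_ratio_sym m_gt0 m_lt_M op_ratio_lower
  op_ratio_upper r.
Qed.

Lemma is_cfc_ratio_log : is_cfc (@ln R) X (op_log X).
Proof.
exact: is_cfc_log op_ratio_bounded op_ratio_sym m_gt0 m_lt_M op_ratio_lower
  op_ratio_upper.
Qed.

(** The passage from scalar inequalities to the Loewner order: the spectrum of [X] lies in [m, M],
    and congruence by the square root of [A] preserves positivity. *)
Lemma positive_congr_ratio (h : R -> R) S : is_cfc h X S ->
  (forall t : R, m <= t <= M -> 0 <= h t) -> positive_op (congr_op F S).
Proof.
move=> cS h0; apply: positive_congr_op; [exact: op_sqrt_bounded|exact: F_sym|..].
- by case: cS.
- exact: (is_cfc_rsymmetric op_ratio_sym cS).
- apply: (is_cfc_ge0 op_ratio_bounded op_ratio_sym cS) => t /op_ratio_spectrum.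
  exact: h0.
Qed.

End ratio.

(** * Identification of the scalar functions behind the operators of the theorem *)

Section scalar_identities.
Context {R : realType}.
Variables (m M : R).
Hypotheses (m_gt0 : 0 < m) (m_lt_M : m < M).

(** The right-hand side keeps its factors 1 and -1 so as to be literally the function that the
    calculus attaches to [L_tsallis], with 1 standing for [id]. *)
Lemma chord_tsallis (p t : R) : p != 0 ->
  chord (fun t => p^-1 * (t `^ p + -1 * 1)) m M t
  = - 1 / (p * (M - m)) * ((M - m + M * m * (M `^ (p - 1) - m `^ (p - 1))) * 1
      + -1 * ((M `^ p - m `^ p) * t)).
Proof.
move=> p0; have M_gt0 := lt_trans m_gt0 m_lt_M.
have pE (u : R) : 0 < u -> u `^ (p - 1) = u `^ p / u.
  move=> u0; rewrite powRD; last by rewrite (gt_eqF u0) implybT.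
  by rewrite powR_inv1 // ltW.
rewrite /chord !pE //; field.
by rewrite p0 !gt_eqF ?subr_gt0.
Qed.

Lemma chord_ln (t : R) :
  chord (@ln R) m M t
  = 1 / (M - m) * (ln M * (t + -1 * (m * 1)) + ln m * (M * 1 + -1 * t)).
Proof. by rewrite /chord; field; rewrite gt_eqF ?subr_gt0. Qed.

Lemma tsallis_derive (p : R) : p != 0 -> forall t : R, 0 < t ->
  is_derive t 1 (fun t => p^-1 * (t `^ p + -1 * 1)) (t `^ (p - 1)).
Proof.
move=> p0 t t0; have pt := is_derive1_powR p t0.
apply: is_derive_eq; rewrite /GRing.scale /=; field; exact: p0.
Qed.

(** Puts the logarithm under the chord bounds, as the case [p = 0]. *)
Lemma ln_derive (t : R) : 0 < t -> is_derive t 1 (@ln R) (t `^ (0 - 1)).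
Proof. by move=> t0; rewrite sub0r powR_inv1 ?(ltW t0) //; exact: is_derive1_ln. Qed.

Lemma tsallis_coef (p c : R) :
  (1 - p) / 2 * c `^ (p - 2) = (1 - p) / (2 * c `^ (2 - p)).
Proof. by rewrite -[p - 2]opprB powRN invfM mulrA. Qed.

Lemma log_coef (c : R) : 0 < c ->
  (1 - 0) / 2 * c `^ (0 - 2) = 1 / (2 * c ^+ 2).
Proof.
by move=> c0; rewrite tsallis_coef !subr0 (powR_mulrn 2 (ltW c0)).
Qed.

(** Thus [K_op] comes from [(X - m)(X - M)]. The exponent 2 is a real one, and agrees with squaring
    because [t >= 0]. *)
Lemma K_scalar (t : R) : m <= t ->
  t `^ 2 + M * m * 1 + -1 * ((M + m) * t) = (t - m) * (t - M).
Proof.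
move=> mt; have t0 := le_trans (ltW m_gt0) mt.
by rewrite (powR_mulrn 2 t0); ring.
Qed.

End scalar_identities.

(** * Transfer of the scalar bounds to operator inequalities *)

Lemma opp_scaleC (R : realType) (H : hilbertType R) (T : H -> H) : - T = (-1)%:C *: T.
Proof. by rewrite rmorphN1 scaleN1r. Qed.

Theorem mainTheorem3 (R : realType) (H : hilbertType R) (A B : H -> H)
    (m M : R)
    (A_bounded : bounded_op A) (A_strictly_pos : strictly_positive_op A)
    (B_bounded : bounded_op B) (B_pos : positive_op B)
    (m_gt0 : 0 < m) (m_lt_M : m < M)
    (mA_le_B : loewner_le (m%:C *: A) B) (B_le_MA : loewner_le B (M%:C *: A)) :
  (forall p : R, -1 <= p -> p <= 1 -> p != 0 ->
     loewner_le
       (L_tsallis m M p A B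
        - ((1 - p) / (2 * M `^ (2 - p)))%:C *: K_op m M A B)
       (tsallis_entropy p A B) /\
     loewner_le
       (tsallis_entropy p A B)
       (L_tsallis m M p A B
        - ((1 - p) / (2 * m `^ (2 - p)))%:C *: K_op m M A B)) /\
  (loewner_le
     (L_log m M A B - (1 / (2 * M ^+ 2))%:C *: K_op m M A B)
     (rel_op_entropy A B) /\
   loewner_le
     (rel_op_entropy A B)
     (L_log m M A B - (1 / (2 * m ^+ 2))%:C *: K_op m M A B)).
Proof.
pose X := op_ratio A B; pose F := op_pow A 2^-1.
have M_gt0 := lt_trans m_gt0 m_lt_M.
have F_bounded := op_sqrt_bounded A_bounded A_strictly_pos.
have X_bounded := op_ratio_bounded A_bounded A_strictly_pos B_bounded.
have congr_id := congr_op_id A_bounded A_strictly_pos.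
have congr_X := congr_op_ratio B A_bounded A_strictly_pos.
have pos := positive_congr_ratio A_bounded A_strictly_pos B_bounded B_pos
  mA_le_B B_le_MA.
have cpow := is_cfc_ratio_pow A_bounded A_strictly_pos B_bounded B_pos
  m_gt0 m_lt_M mA_le_B B_le_MA.
have clog := is_cfc_ratio_log A_bounded A_strictly_pos B_bounded B_pos
  m_gt0 m_lt_M mA_le_B B_le_MA.
have cX := is_cfc_id X_bounded; have c1 := is_cfc_one X_bounded.
have congrE := (congr_opD F_bounded, congr_opZ F_bounded).
(* Built in the same order as the calculus lemmas are applied in [cK], so that the two match. *)
pose KX := op_pow X 2 + (M * m)%:C *: id + (-1)%:C *: ((M + m)%:C *: X).
have cK := is_cfcD (is_cfcD (cpow 2) (is_cfcZ (M * m) c1))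
  (is_cfcZ (-1) (is_cfcZ (M + m) cX)).
rewrite -/KX in cK.
have KE : K_op m M A B = congr_op F KX.
  by rewrite /KX !congrE congr_id congr_X /K_op opp_scaleC.
(* From here on [KX] is known only through [cK] and [KE], so that rewriting with [congrE] leaves it
   whole. *)
clearbody KX.
(* Common to the four inequalities: [f] is the function of the entropy, [l] its chord, and [k] the
   coefficient of [K_op]. *)
have main (f l : R -> R) S L k : is_cfc f X S -> is_cfc l X L ->
  ((forall t : R, m <= t <= M -> l t - k * ((t - m) * (t - M)) <= f t) ->
     loewner_le (congr_op F L - k%:C *: K_op m M A B) (congr_op F S)) /\
  ((forall t : R, m <= t <= M -> f t <= l t - k * ((t - m) * (t - M))) ->
     loewner_le (congr_op F S) (congr_op F L - k%:C *: K_op m M A B)).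
  move=> cS cL; have cLK := is_cfcD cL (is_cfcZ (-1) (is_cfcZ k cK)).
  have LKE : congr_op F L - k%:C *: K_op m M A B
           = congr_op F (L + (-1)%:C *: (k%:C *: KX)).
    by rewrite !congrE KE -opp_scaleC.
  rewrite LKE /loewner_le; split=> fl.
    rewrite -(congr_opB F_bounded).
    apply: pos (is_cfcD cS (is_cfcZ (-1) cLK)) _ => t tmM.
    by rewrite (K_scalar M m_gt0) ?(andP tmM).1 //; have := fl t tmM; lra.
  rewrite -(congr_opB F_bounded).
  apply: pos (is_cfcD cLK (is_cfcZ (-1) cS)) _ => t tmM.
  by rewrite (K_scalar M m_gt0) ?(andP tmM).1 //; have := fl t tmM; lra.
split=> [p _ p1 p0|].
  have TE : tsallis_entropy p A B
      = congr_op F ((p^-1)%:C *: (op_pow X p + (-1)%:C *: id)).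
    by rewrite !congrE congr_id /tsallis_entropy opp_scaleC.
  have LE : L_tsallis m M p A B = congr_op F ((- 1 / (p * (M - m)))%:C *:
      ((M - m + M * m * (M `^ (p - 1) - m `^ (p - 1)))%:C *: id
       + (-1)%:C *: ((M `^ p - m `^ p)%:C *: X))).
    by rewrite !congrE congr_id congr_X /L_tsallis opp_scaleC.
  have cS := is_cfcZ p^-1 (is_cfcD (cpow p) (is_cfcZ (-1) c1)).
  have cL := is_cfcZ (- 1 / (p * (M - m)))
    (is_cfcD (is_cfcZ (M - m + M * m * (M `^ (p - 1) - m `^ (p - 1))) c1)
             (is_cfcZ (-1) (is_cfcZ (M `^ p - m `^ p) cX))).
  rewrite TE LE; split.
    apply: (main _ _ _ _ _ cS cL).1 => t tmM.
    rewrite -(chord_tsallis m_gt0 m_lt_M t p0) -tsallis_coef.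
    exact: (chord_lower_bound p1 m_gt0 m_lt_M (tsallis_derive p0) tmM).
  apply: (main _ _ _ _ _ cS cL).2 => t tmM.
  rewrite -(chord_tsallis m_gt0 m_lt_M t p0) -tsallis_coef.
  exact: (chord_upper_bound p1 m_gt0 m_lt_M (tsallis_derive p0) tmM).
have LE : L_log m M A B = congr_op F ((1 / (M - m))%:C *:
    ((ln M)%:C *: (X + (-1)%:C *: (m%:C *: id))
     + (ln m)%:C *: (M%:C *: id + (-1)%:C *: X))).
  by rewrite !congrE congr_id congr_X /L_log !opp_scaleC.
have cL := is_cfcZ (1 / (M - m))
  (is_cfcD (is_cfcZ (ln M) (is_cfcD cX (is_cfcZ (-1) (is_cfcZ m c1))))
           (is_cfcZ (ln m) (is_cfcD (is_cfcZ M c1) (is_cfcZ (-1) cX)))).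
rewrite LE; split.
  (* The chord bounds are used with [p = 0], whose condition [p <= 1] is [ler01]. *)
  apply: (main _ _ _ _ _ clog cL).1 => t tmM.
  rewrite -(chord_ln m_lt_M t) -(log_coef M_gt0).
  exact: (chord_lower_bound ler01 m_gt0 m_lt_M (@ln_derive R) tmM).
apply: (main _ _ _ _ _ clog cL).2 => t tmM.
rewrite -(chord_ln m_lt_M t) -(log_coef m_gt0).
exact: (chord_upper_bound ler01 m_gt0 m_lt_M (@ln_derive R) tmM).
Qed.
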